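(* Let $P=(p_{xy})_{x,y\in X}$ be an ergodic, reversible Markov chain on a finite state space $X$, $|X|=n$, with stationary distribution $\pi$, and let $M\subset X$ be a nonempty set of marked elements, $U=X\setminus M$, $p_M=\sum_{x\in M}\pi_x$, and assume $p_M\leq 1/2$. Let $P'$ be obtained from $P$ by replacing all outgoing transitions from $M$ by self-loops (i.e. rows of $P'$ indexed by $x\in M$ are the standard basis rows $e_x$, the other rows equal those of $P$), and for $s\in[0,1]$ let $P(s)=(1-s)P+sP'$ with entries $p_{xy}(s)$. Let $D(P(s))$, with entries $\sqrt{p_{xy}(s)p_{yx}(s)}$, have spectral decomposition $\sum_{i=1}^n\lambda_i(s)\ket{v_i(s)}\bra{v_i(s)}$ with $1=\lambda_n(s)>\lambda_{n-1}(s)\ge\dots\ge\lambda_1(s)$ for $s\in[0,1)$. Let $\ket{U}=\frac{1}{\sqrt{1-p_M}}\sum_{x\in U}\sqrt{\pi_x}\ket{x}$, define the interpolated hitting time $HT(s)=\sum_{j=1}^{n-1}\frac{|\braket{v_j(s)}{U}|^2}{1-\lambda_j(s)}$ and the extended hitting time $HT^+(P,M)=\lim_{s\to1}HT(s)$. On $\mathcal{H}\otimes\mathcal{H}$, $\mathcal{H}=\mathrm{span}\{\ket{x}:x\in X\}$, with fixed reference state $\ket{0}\in\mathcal{H}$, let $V(s)$ be a unitary with $V(s)\ket{x,0}=\sum_{y}\sqrt{p_{xy}(s)}\ket{x,y}$, let $S\ket{x,y}=\ket{y,x}$ if $p_{xy}>0$ and $S\ket{x,y}=\ket{x,y}$ otherwise,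 $\Pi_0=I\otimes\ket{0}\bra{0}$, and $H(s)=i[V(s)^\dagger S V(s),\Pi_0]$. Let $s^*=1-\frac{p_M}{1-p_M}$ and $\ket{v_n(0)}=\sum_{x\in X}\sqrt{\pi_x}\ket{x}$. For $T>0$ define $$\bar\rho(T)=\frac1T\int_0^T e^{-iH(s^* )t}\ket{v_n(0),0}\bra{v_n(0),0}e^{iH(s^* )t}\,dt,$$ the expected state obtained by evolving $\ket{v_n(0),0}$ under $H(s^* )$ for a time chosen uniformly at random in $[0,T]$, and let $\Pi_M=\sum_{x\in M}\ket{x}\bra{x}$. Then for every $\varepsilon\in(0,1/4)$ and every $$T\geq\frac1\varepsilon\sqrt{\frac{HT^+(P,M)}{2}},$$ measuring the first register of $\bar\rho(T)$ in the basis $\{\ket{x}\}$ yields an element of $M$ with probability $\mathrm{Tr}[(\Pi_M\otimes I)\bar\rho(T)]\geq 1/4-\varepsilon$.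
   Context: Standing convention: Markov chains are taken lazy, $P\mapsto (I+P)/2$, so eigenvalues lie in $[0,1]$. Ergodic = irreducible and aperiodic; reversible = $\pi_xp_{xy}=\pi_yp_{yx}$. For $s\in[0,1)$, $P(s)$ is ergodic and reversible. *)

(* Defs.v *)
(* MathComp + MathComp-Analysis + real_closed (complex, mxtens) *)
From HB Require Import structures.
From mathcomp Require Import all_boot all_order all_algebra.
From mathcomp Require Import all_classical all_reals all_analysis.
From mathcomp Require Import complex mxtens sesquilinear spectral.
Set Implicit Arguments. Unset Strict Implicit. Unset Printing Implicit Defensive.
Import Order.TTheory GRing.Theory Num.Theory.
Import numFieldNormedType.Exports.
Local Open Scope ring_scope.

(* The state space X is 'I_n (|X| = n).  Markov chains are n x n real matrices
   P with P x y = p_{xy}. *)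

Definition stochastic (R : realType) (n : nat) (P : 'M[R]_n) : Prop :=
  (forall x y, 0 <= P x y) /\ (forall x, \sum_(y < n) P x y = 1).

(* Standing convention: chains are lazy, P = (I + Q)/2 with Q stochastic. *)
Definition lazy_chain (R : realType) (n : nat) (P : 'M[R]_n) : Prop :=
  exists Q : 'M[R]_n, stochastic Q /\ P = 2^-1 *: (1%:M + Q).

Definition irreducible (R : realType) (n : nat) (P : 'M[R]_n) : Prop :=
  forall x y : 'I_n, exists k : nat, 0 < (P ^+ k) x y.

(* aperiodic: for every state the gcd of the return times is 1 *)
Definition aperiodic (R : realType) (n : nat) (P : 'M[R]_n) : Prop :=
  forall (x : 'I_n) (d : nat),
    (forall k : nat, (0 < k)%N -> 0 < (P ^+ k) x x -> (d %| k)%N) -> d = 1%N.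

Definition ergodic (R : realType) (n : nat) (P : 'M[R]_n) : Prop :=
  stochastic P /\ irreducible P /\ aperiodic P.

Definition stationary (R : realType) (n : nat) (P : 'M[R]_n) (pi : 'I_n -> R) : Prop :=
  (forall x, 0 <= pi x) /\ \sum_(x < n) pi x = 1 /\
  (forall y, \sum_(x < n) pi x * P x y = pi y).

Definition reversible (R : realType) (n : nat) (P : 'M[R]_n) (pi : 'I_n -> R) : Prop :=
  forall x y, pi x * P x y = pi y * P y x.

(* p_M *)
Definition pM (R : realType) (n : nat) (pi : 'I_n -> R) (M : {set 'I_n}) : R :=
  \sum_(x in M) pi x.

(* P' : outgoing transitions from M replaced by self-loops *)
Definition absorbing (R : realType) (n : nat) (P : 'M[R]_n) (M : {set 'I_n}) : 'M[R]_n :=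
  \matrix_(x, y) (if x \in M then (x == y)%:R else P x y).

(* P(s) = (1-s) P + s P' *)
Definition interp (R : realType) (n : nat) (P : 'M[R]_n) (M : {set 'I_n}) (s : R) : 'M[R]_n :=
  (1 - s) *: P + s *: absorbing P M.

(* discriminant matrix D(A), entries sqrt(a_xy a_yx) *)
Definition discr (R : realType) (n : nat) (A : 'M[R]_n) : 'M[R]_n :=
  \matrix_(x, y) Num.sqrt (A x y * A y x).

(* (lam, v) is a spectral decomposition D = sum_i lam_i |v_i><v_i| with
   orthonormal v_i, indexed so that 1 = lam_n > lam_{n-1} >= ... >= lam_1
   (index i : 'I_n corresponds to i+1; the top index is n.-1). *)
Definition spec_dec (R : realType) (n : nat) (D : 'M[R]_n)
    (lam : 'I_n -> R) (v : 'I_n -> 'I_n -> R) : Prop :=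
  (forall i j : 'I_n, \sum_(x < n) v i x * v j x = (i == j)%:R) /\
  D = \sum_(i < n) lam i *: \matrix_(x, y) (v i x * v i y) /\
  (forall i : 'I_n, val i = n.-1 -> lam i = 1) /\
  (forall i : 'I_n, (val i < n.-1)%N -> lam i < 1) /\
  (forall i j : 'I_n, (val i <= val j)%N -> lam i <= lam j).

(* |U> = (1-p_M)^{-1/2} sum_{x in U} sqrt(pi_x) |x> *)
Definition Uvec (R : realType) (n : nat) (pi : 'I_n -> R) (M : {set 'I_n}) : 'I_n -> R :=
  fun x => if x \in M then 0 else Num.sqrt (pi x) / Num.sqrt (1 - pM pi M).

(* sum_{j=1}^{n-1} |<v_j|U>|^2 / (1 - lam_j) *)
Definition HT_of (R : realType) (n : nat) (lam : 'I_n -> R) (v : 'I_n -> 'I_n -> R)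
    (u : 'I_n -> R) : R :=
  \sum_(j < n | (val j < n.-1)%N) (\sum_(x < n) v j x * u x) ^+ 2 / (1 - lam j).

(* s* = 1 - p_M / (1 - p_M) *)
Definition sstar (R : realType) (n : nat) (pi : 'I_n -> R) (M : {set 'I_n}) : R :=
  1 - pM pi M / (1 - pM pi M).

(* ---------------- quantum part, over C = R[i] ---------------- *)
Local Open Scope complex_scope.
Local Open Scope sesquilinear_scope.

(* basis ket |x> *)
Definition ket (R : realType) (n : nat) (x : 'I_n) : 'cV[R[i]]_n :=
  \col_(y < n) (x == y)%:R.

(* sum_y sqrt(p_xy) |y> for a real matrix A *)
Definition sqrt_row (R : realType) (n : nat) (A : 'M[R]_n) (x : 'I_n) : 'cV[R[i]]_n :=
  \col_(y < n) (Num.sqrt (A x y))%:C.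

(* S|x,y> = |y,x> if p_xy > 0, |x,y> otherwise (tensor index via mxtens) *)
Definition swapS (R : realType) (n : nat) (P : 'M[R]_n) : 'M[R[i]]_(n * n) :=
  \matrix_(r, c)
    (let a := (mxtens_unindex r).1 in let b := (mxtens_unindex r).2 in
     let x := (mxtens_unindex c).1 in let y := (mxtens_unindex c).2 in
     if 0 < P x y then ((a == y) && (b == x))%:R else ((a == x) && (b == y))%:R).

(* Pi_0 = I (x) |0><0| *)
Definition Pi0 (R : realType) (n : nat) (z : 'cV[R[i]]_n) : 'M[R[i]]_(n * n) :=
  (1%:M : 'M[R[i]]_n) *t (z *m z ^t*).

(* H = i [V^dag S V, Pi_0] *)
Definition Hop (R : realType) (n : nat) (P : 'M[R]_n) (V : 'M[R[i]]_(n * n))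
    (z : 'cV[R[i]]_n) : 'M[R[i]]_(n * n) :=
  let A := (V ^t* *m swapS P *m V) in
  'i *: (A *m Pi0 z - Pi0 z *m A).

(* matrix exponential exp(A) = sum_k A^k / k!, limit taken entrywise
   (real and imaginary parts) *)
Definition expS (R : realType) (m : nat) (A : 'M[R[i]]_m) (N : nat) : 'M[R[i]]_m :=
  \sum_(k < N) (k`!%:R)^-1 *: A ^+ k.

Definition expmx (R : realType) (m : nat) (A : 'M[R[i]]_m) : 'M[R[i]]_m :=
  \matrix_(i, j) (limn (fun N => complex.Re (expS A N i j)) +i* limn (fun N => complex.Im (expS A N i j))).

(* |v_n(0), 0> = sum_x sqrt(pi_x) |x> (x) |0> *)
Definition psi0 (R : realType) (n : nat) (pi : 'I_n -> R) (z : 'cV[R[i]]_n) : 'cV[R[i]]_(n * n) :=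
  (\col_(x < n) (Num.sqrt (pi x))%:C) *t z.

(* rho(t) = e^{-iHt} |psi0><psi0| e^{iHt} *)
Definition rho (R : realType) (n : nat) (H : 'M[R[i]]_(n * n)) (psi : 'cV[R[i]]_(n * n))
    (t : R) : 'M[R[i]]_(n * n) :=
  expmx ((- 'i * t%:C) *: H) *m (psi *m psi ^t*) *m expmx (('i * t%:C) *: H).

(* rhobar(T) = (1/T) int_0^T rho(t) dt  (entrywise Lebesgue integral) *)
Definition rhobar (R : realType) (n : nat) (H : 'M[R[i]]_(n * n)) (psi : 'cV[R[i]]_(n * n))
    (T : R) : 'M[R[i]]_(n * n) :=
  \matrix_(i, j)
    ((T^-1 * Rintegral (@lebesgue_measure R) `[0, T]%classic
                (fun t => complex.Re (rho H psi t i j)))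
     +i* (T^-1 * Rintegral (@lebesgue_measure R) `[0, T]%classic
                (fun t => complex.Im (rho H psi t i j)))).

(* Pi_M = sum_{x in M} |x><x| *)
Definition PiM (R : realType) (n : nat) (M : {set 'I_n}) : 'M[R[i]]_n :=
  \matrix_(x, y) ((x == y) && (x \in M))%:R.

Arguments ket {R n} x.
Arguments PiM {R n} M.

(* Main.v *)
(** Write |v> for the unit vector with amplitudes sqrt(pi(s^star)) and D for the
    discriminant of P(s^star).

    Dynamics: A = V^dag S V is a self-adjoint involution which compresses to D on
    the vectors |w,0>, so the walk Hamiltonian satisfies H^2 |w,0> = |(1 - D^2) w, 0>,
    kills |v,0>, and maps the vectors |w,0> to their orthogonal complement.  Decompose the
    initial state as a |v,0> + H chi with chi = H |w,0>.  Dropping the square of the second summand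
    leaves a^2 |Pi_M v|^2 and a cross term which is a time derivative, namely that of
    2a Re(i <Pi_M v,0| e^{-iHt} chi>); its time average is therefore at most
    2a |Pi_M v| |chi| / T, since <Pi_M v,0|chi> = 0 and the evolution is unitary.

    Hitting times: |chi|^2 = <w, (1 - D^2) w> is bounded, as D >= 0 by laziness, by a
    multiple of the Poisson form HT(s^star) = <y, (1 - D) y>.  Rescaling by the diagonal
    matrix G(s) with entries sqrt(1 - s) on M and 1 elsewhere gives
    1 - D(P(s)) = G(s) (1 - D(P)) G(s), whence HT(s) = K (p_M / (p_M + (1 - s)(1 - p_M)))^2
    with K independent of s; thus K = HT^+ and HT(s^star) = HT^+ / 4. *)
Require Import Defs.
From HB Require Import structures.
From mathcomp Require Import all_boot all_order all_algebra.
From mathcomp Require Import all_classical all_reals all_analysis.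
From mathcomp Require Import complex mxtens sesquilinear spectral.
From mathcomp Require Import ring lra.
Import Order.TTheory GRing.Theory Num.Theory.
Import numFieldNormedType.Exports.
Local Open Scope ring_scope.
Local Open Scope complex_scope.
Local Open Scope sesquilinear_scope.
Set Implicit Arguments. Unset Strict Implicit. Unset Printing Implicit Defensive.

(** * Exponentials of Hermitian matrices *)

(** Eigenvalues of a Hermitian matrix are real and are stored as reals, so that the phases of the
    evolution become cosines and sines of real arguments. *)
Lemma hermitian_spectral (R : realType) (m : nat) (H : 'M[R[i]]_m) :
  H ^t* = H ->
  exists (Q : 'M[R[i]]_m) (mu : 'I_m -> R),
    Q \is unitarymx /\ H = Q ^t* *m diag_mx (\row_k (mu k)%:C) *m Q.
Proof.
move=> HH.
have Hh : H \is hermsymmx by apply/is_hermitianmxP; rewrite expr0 scale1r HH.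
exists (spectralmx H), (fun k => complex.Re (spectral_diag H 0 k)).
split; first exact: spectral_unitarymx.
have /orthomx_spectralP {1}-> := hermitian_normalmx Hh.
rewrite invmx_unitary ?spectral_unitarymx//; congr (_ *m diag_mx _ *m _).
apply/rowP=> k; rewrite !mxE RRe_real//.
exact: (mxOverP (hermitian_spectral_diag_real Hh)).
Qed.

(** * The scalar exponential exp(ix) and its partial sums *)

Definition cis (R : realType) (x : R) : R[i] := cos x +i* sin x.

Lemma RecM (R : realType) (x y : R[i]) :
  complex.Re (x * y) = complex.Re x * complex.Re y - complex.Im x * complex.Im y.
Proof. by case: x; case: y. Qed.

Lemma ImcM (R : realType) (x y : R[i]) :
  complex.Im (x * y) = complex.Re x * complex.Im y + complex.Im x * complex.Re y.
Proof. by case: x => a b; case: y. Qed.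

Lemma Rec_sum (R : realType) (I : Type) (r : seq I) (Q : pred I) (F : I -> R[i]) :
  complex.Re (\sum_(i <- r | Q i) F i) = \sum_(i <- r | Q i) complex.Re (F i).
Proof. by elim/big_rec2: _ => // i y1 y2 _ <-; case: (F i); case: y2. Qed.

Lemma Imc_sum (R : realType) (I : Type) (r : seq I) (Q : pred I) (F : I -> R[i]) :
  complex.Im (\sum_(i <- r | Q i) F i) = \sum_(i <- r | Q i) complex.Im (F i).
Proof. by elim/big_rec2: _ => // i y1 y2 _ <-; case: (F i); case: y2. Qed.

(** Powers of i alternate between real and imaginary, so the parity of [l] decides which of the two
    coefficients survives. *)
Lemma expc_coeff (R : realType) (x : R) (l : nat) :
  (l`!%:R)^-1 * ('i * x%:C) ^+ l = (cos_coeff x l) +i* (sin_coeff x l).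
Proof.
have -> : (l`!%:R : R[i])^-1 = ((l`!%:R)^-1)%:C by rewrite fmorphV/= rmorph_nat.
rewrite exprMn -rmorphXn/= [in 'i ^+ l](divn_eq l 2) exprD mulnC exprM sqr_i.
rewrite /cos_coeff /sin_coeff /= -exprnP divn2 modn2.
have -> : (-1 : R[i]) ^+ l./2 = ((-1) ^+ l./2)%:C by rewrite rmorphXn rmorphN1.
(* The sine coefficient carries the exponent [l.-1./2], which agrees with [l./2] for odd [l]. *)
have hs : odd l -> l.-1./2 = l./2.
  by case: l => //= l /negbTE; rewrite uphalf_half => ->.
case: (boolP (odd l)) => [/hs ->|_] /=; apply/eqP;
  rewrite eq_complex ?expr1 ?expr0 !RecM !ImcM /=;
  rewrite !(oppr0, mulr1, mul0r, mulr0, subr0, addr0, add0r, mul1r, subrr);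
  by rewrite [l`!%:R^-1 * _]mulrC !eqxx.
Qed.

Definition ecis (R : realType) (x : R) (N : nat) : R[i] :=
  \sum_(l < N) (l`!%:R)^-1 * ('i * x%:C) ^+ l.

Lemma cvg_Re_ecis (R : realType) (x : R) :
  (complex.Re (ecis x N) @[N --> \oo] --> cos x)%classic.
Proof.
rewrite cos.unlock.
rewrite (_ : (fun N => _) = series (cos_coeff x)); last first.
  apply/funext => N; rewrite /series/= Rec_sum big_mkord.
  by apply: eq_bigr => l _; rewrite expc_coeff.
exact: is_cvg_series_cos_coeff.
Qed.

Lemma cvg_Im_ecis (R : realType) (x : R) :
  (complex.Im (ecis x N) @[N --> \oo] --> sin x)%classic.
Proof.
rewrite sin.unlock.
rewrite (_ : (fun N => _) = series (sin_coeff x)); last first.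
  apply/funext => N; rewrite /series/= Imc_sum big_mkord.
  by apply: eq_bigr => l _; rewrite expc_coeff.
exact: is_cvg_series_sin_coeff.
Qed.

Lemma conjmx_diagE (R : realType) (m : nat) (Q : 'M[R[i]]_m) (d : 'I_m -> R[i]) i j :
  (Q ^t* *m diag_mx (\row_k d k) *m Q) i j = \sum_k (Q k i)^* * Q k j * d k.
Proof.
rewrite mxE; apply: eq_bigr => k _; rewrite mul_mx_diag !mxE mulrAC //.
Qed.

Lemma expr_conj_diag (R : realType) (m : nat) (Q : 'M[R[i]]_m) (d : 'I_m -> R[i]) l :
  Q \is unitarymx ->
  (Q ^t* *m diag_mx (\row_k d k) *m Q) ^+ l =
  Q ^t* *m diag_mx (\row_k d k ^+ l) *m Q.
Proof.
move=> QU; have QQ : Q *m Q ^t* = 1%:M by apply/unitarymxP.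
elim: l => [|l IH].
  rewrite expr0 (_ : \row_k _ = const_mx 1); last by apply/rowP=> k; rewrite !mxE expr0.
  by rewrite diag_const_mx mulmx1 (mulmx1C QQ).
rewrite exprS IH -mulmxE !mulmxA -[_ *m Q *m Q ^t*]mulmxA QQ mulmx1.
rewrite -[_ *m diag_mx _ *m diag_mx _]mulmxA mulmx_diag.
by congr (_ *m diag_mx _ *m _); apply/rowP => k; rewrite !mxE exprS.
Qed.

Lemma exprZmx (F : comPzRingType) (m : nat) (c : F) (A : 'M[F]_m) l :
  (c *: A) ^+ l = c ^+ l *: A ^+ l.
Proof.
elim: l => [|l IH]; first by rewrite !expr0 scale1r.
by rewrite !exprS IH -!mulmxE -scalemxAl -scalemxAr scalerA.
Qed.

Lemma cvgn_sum (R : realType) (I : Type) (r : seq I) (F : I -> nat -> R) (a : I -> R) :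
  (forall i, F i N @[N --> \oo] --> a i)%classic ->
  (\sum_(i <- r) F i N @[N --> \oo] --> \sum_(i <- r) a i)%classic.
Proof.
move=> Fa; elim: r => [|i r IH].
  rewrite big_nil (_ : (fun N => _) = fun=> 0); first exact: cvg_cst.
  by apply/funext => N; rewrite big_nil.
rewrite big_cons (_ : (fun N => _) = fun N => F i N + \sum_(j <- r) F j N).
  exact: cvgD.
by apply/funext => N; rewrite big_cons.
Qed.

(** Powers of a conjugated diagonal matrix act on the diagonal alone, so each entry of a partial sum
    is a fixed finite combination of scalar partial sums [ecis], whose limits are known. *)
Lemma expmx_spectral (R : realType) (m : nat) (Q : 'M[R[i]]_m) (mu : 'I_m -> R) (x : R) :
  Q \is unitarymx ->
  expmx (('i * x%:C) *: (Q ^t* *m diag_mx (\row_k (mu k)%:C) *m Q)) =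
  Q ^t* *m diag_mx (\row_k cis (x * mu k)) *m Q.
Proof.
move=> QU; apply/matrixP => i j; rewrite [LHS]mxE conjmx_diagE.
have expSE N : expS (('i * x%:C) *: (Q ^t* *m diag_mx (\row_k (mu k)%:C) *m Q)) N i j
    = \sum_k (Q k i)^* * Q k j * ecis (x * mu k) N.
  rewrite /expS summxE.
  under eq_bigr => l _.
    rewrite exprZmx expr_conj_diag// scalerA mxE conjmx_diagE mulr_sumr.
    over.
  rewrite exchange_big; apply: eq_bigr => k _; rewrite mulr_sumr.
  apply: eq_bigr => l _.
  have -> : 'i * (x * mu k)%:C = 'i * x%:C * (mu k)%:C by rewrite rmorphM mulrA.
  by rewrite [in RHS]exprMn mulrCA !mulrA.
apply/eqP; rewrite eq_complex/= Rec_sum Imc_sum; apply/andP; split; apply/eqP; apply: cvg_lim => //.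
  rewrite (_ : (fun N => _) = fun N =>
    \sum_k (complex.Re ((Q k i)^* * Q k j) * complex.Re (ecis (x * mu k) N)
    - complex.Im ((Q k i)^* * Q k j) * complex.Im (ecis (x * mu k) N))); last first.
    by apply/funext => N; rewrite expSE Rec_sum; apply: eq_bigr => k _; rewrite (RecM _ (ecis _ _)).
  apply: cvgn_sum => k; rewrite (RecM _ (cis _)).
  exact: (cvgB (cvgMl_tmp (@cvg_Re_ecis _ _)) (cvgMl_tmp (@cvg_Im_ecis _ _))).
rewrite (_ : (fun N => _) = fun N =>
    \sum_k (complex.Re ((Q k i)^* * Q k j) * complex.Im (ecis (x * mu k) N)
    + complex.Im ((Q k i)^* * Q k j) * complex.Re (ecis (x * mu k) N))); last first.
  by apply/funext => N; rewrite expSE Imc_sum; apply: eq_bigr => k _; rewrite (ImcM _ (ecis _ _)).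
apply: cvgn_sum => k; rewrite (ImcM _ (cis _)).
exact: (cvgD (cvgMl_tmp (@cvg_Im_ecis _ _)) (cvgMl_tmp (@cvg_Re_ecis _ _))).
Qed.

(** * Trigonometric sums and their integrals *)

(** Meant for [g] the cross term of a probability and [G] its antiderivative: the oscillating part
    then contributes boundary values only. *)
Lemma integral_ge_FTC (R : realType) (f g G : R -> R) (c T : R) : 0 < T ->
  continuous f -> continuous g -> (forall t : R, is_derive t (1:R) G (g t)) ->
  (forall t, c + g t <= f t) ->
  c * T + (G T - G 0) <= Rintegral (@lebesgue_measure R) `[0, T]%classic f.
Proof.
move=> T0 cf cg dG le.
have cfT : {within `[0, T]%classic, continuous f}%classic by exact: continuous_subspaceT.
have ch : continuous (fun t => c + g t).
  by move=> x; apply: cvgD; [exact: cvg_cst|exact: cg].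
have chT : {within `[0, T]%classic, continuous (fun t => c + g t)}%classic.
  exact: continuous_subspaceT.
have dK t : is_derive t (1 : R) (fun t => c * t + G t) (c + g t).
  apply: is_deriveD.
  rewrite -[X in is_derive _ _ _ X]mulr1; exact: is_deriveZ.
have cK : continuous (fun t => c * t + G t).
  by move=> t; apply: differentiable_continuous; apply/derivable1_diffP; apply: ex_derive.
have <- : Rintegral (@lebesgue_measure R) `[0, T]%classic (fun t => c + g t) = c * T + (G T - G 0).
  rewrite /Rintegral (@continuous_FTC2 _ (fun t => c + g t) (fun t => c * t + G t))//.
  - by rewrite -EFinB /= mulr0 add0r addrA.
  - split => [t _||]; first exact: ex_derive.
    + by apply: cvg_at_right_filter; apply: cK.
    + by apply: cvg_at_left_filter; apply: cK.
  - by move=> t _; rewrite derive1E; apply: derive_val.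
apply: le_Rintegral => //; apply: continuous_compact_integrable => //; exact: segment_compact.
Qed.

(** The shape taken by amplitudes of the evolution in the eigenbasis; the sign of [t] is that of
    e^{-iHt}. *)
Definition trig (R : realType) (m : nat) (mu : 'I_m -> R) (al : 'I_m -> R[i]) (t : R) : R :=
  complex.Re (\sum_k al k * cis (- t * mu k)).

Lemma trigE (R : realType) (m : nat) (mu : 'I_m -> R) (al : 'I_m -> R[i]) (t : R) :
  trig mu al t =
  \sum_k (complex.Re (al k) * cos (mu k * t) + complex.Im (al k) * sin (mu k * t)).
Proof.
rewrite /trig Rec_sum; apply: eq_bigr => k _.
by rewrite RecM /= mulNr cosN sinN mulrN opprK [t * _]mulrC.
Qed.

Lemma is_derive_trig (R : realType) (m : nat) (mu : 'I_m -> R) (al : 'I_m -> R[i]) (t : R) :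
  is_derive t (1 : R) (trig mu al) (trig mu (fun k => - 'i * (mu k)%:C * al k) t).
Proof.
rewrite trigE (_ : trig mu al = \sum_k (fun t =>
  complex.Re (al k) * cos (mu k * t) + complex.Im (al k) * sin (mu k * t))); last first.
  by apply/funext => u; rewrite trigE fct_sumE.
apply: is_derive_sum => k.
have dm : is_derive t (1 : R) ( *%R (mu k)) (mu k).
  rewrite -[X in is_derive _ _ _ X]mulr1; exact: is_deriveZ.
have dc := is_derive1_comp (is_derive_cos (mu k * t)) dm.
have ds := is_derive1_comp (is_derive_sin (mu k * t)) dm.
have dcs := is_deriveD (is_deriveZ (complex.Re (al k)) dc) (is_deriveZ (complex.Im (al k)) ds).
apply: (is_derive_eq dcs).
case: (al k) => a b /=; rewrite /GRing.scale/=; ring.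
Qed.

Lemma continuous_trig (R : realType) (m : nat) (mu : 'I_m -> R) (al : 'I_m -> R[i]) :
  continuous (trig mu al).
Proof.
move=> t; apply: differentiable_continuous; apply/derivable1_diffP.
by have := is_derive_trig mu al t; case.
Qed.

(** * Time averages of unitary evolutions *)

Definition normsq (R : realType) (m : nat) (u : 'cV[R[i]]_m) : R :=
  \sum_k (complex.Re (u k 0) ^+ 2 + complex.Im (u k 0) ^+ 2).

Lemma mulcJ (R : realType) (x : R[i]) :
  x * x^* = (complex.Re x ^+ 2 + complex.Im x ^+ 2)%:C.
Proof. by rewrite add_Re2_Im2 sqr_normc. Qed.

Lemma normsqE (R : realType) (m : nat) (u : 'cV[R[i]]_m) :
  u ^t* *m u = (normsq u)%:C%:M.
Proof.
apply/matrixP => i j; rewrite !ord1 !mxE eqxx mulr1n /normsq rmorph_sum.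
by apply: eq_bigr => k _; rewrite !mxE mulrC mulcJ.
Qed.

Lemma normsq_ge0 (R : realType) (m : nat) (u : 'cV[R[i]]_m) : 0 <= normsq u.
Proof. by apply: sumr_ge0 => k _; rewrite addr_ge0 ?sqr_ge0. Qed.

Lemma normsq_eq0 (R : realType) (m : nat) (u : 'cV[R[i]]_m) : normsq u = 0 -> u = 0.
Proof.
move=> u0; apply/matrixP => k j; rewrite ord1 mxE.
have /psumr_eq0P := u0 => /(_ (fun _ _ => addr_ge0 (sqr_ge0 _) (sqr_ge0 _)) k isT).
move/eqP; rewrite paddr_eq0 ?sqr_ge0// !sqrf_eq0 => /andP[/eqP a /eqP b].
by apply/eqP; rewrite eq_complex a b !eqxx.
Qed.

(** Stated for rectangular isometries, to serve both the evolution and the embedding [ancilla]. *)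
Lemma normsq_unitary (R : realType) (m k : nat) (Q : 'M[R[i]]_(m, k)) (u : 'cV[R[i]]_k) :
  Q ^t* *m Q = 1%:M -> normsq (Q *m u) = normsq u.
Proof.
move=> QQ; have := normsqE (Q *m u).
rewrite trmx_mul map_mxM mulmxA -[_ *m _ *m Q]mulmxA QQ mulmx1 normsqE.
by move/matrixP/(_ 0 0); rewrite !mxE eqxx !mulr1n => /complexI.
Qed.

Lemma sum_CauchySchwarz (R : realType) (I : finType) (x y : I -> R) :
  (\sum_i x i * y i) ^+ 2 <= (\sum_i x i ^+ 2) * (\sum_i y i ^+ 2).
Proof.
(* Lagrange's identity *)
rewrite -subr_ge0 -(@pmulr_rge0 _ 2)//.
have -> : 2 * ((\sum_i x i ^+ 2) * (\sum_i y i ^+ 2) - (\sum_i x i * y i) ^+ 2) =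
    \sum_i \sum_j (x i * y j - x j * y i) ^+ 2.
  have -> : \sum_i \sum_j (x i * y j - x j * y i) ^+ 2 =
    (\sum_i \sum_j x i ^+ 2 * y j ^+ 2 + \sum_i \sum_j y i ^+ 2 * x j ^+ 2)
      - 2 * \sum_i \sum_j (x i * y i) * (x j * y j).
    rewrite mulr_sumr -big_split -sumrB; apply: eq_bigr => i _ /=.
    rewrite mulr_sumr -big_split -sumrB; apply: eq_bigr => j _ /=; ring.
  rewrite -!big_distrlr /=; ring.
by apply: sumr_ge0 => i _; apply: sumr_ge0 => j _; exact: sqr_ge0.
Qed.

(** Cauchy-Schwarz in two stages: each summand is bounded by the product of the moduli, and the real
    inequality is applied to the vectors of moduli. *)
Lemma Re_form_ge (R : realType) (m : nat) (u v : 'cV[R[i]]_m) :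
  - Num.sqrt (normsq u * normsq v) <= complex.Re ('i * (u ^t* *m v) 0 0).
Proof.
pose nn (w : 'cV[R[i]]_m) k := Num.sqrt (complex.Re (w k 0) ^+ 2 + complex.Im (w k 0) ^+ 2).
have nnE w : normsq w = \sum_k nn w k ^+ 2.
  by apply: eq_bigr => k _; rewrite sqr_sqrtr// addr_ge0 ?sqr_ge0.
have le1 : \sum_k nn u k * nn v k <= Num.sqrt (normsq u * normsq v).
  rewrite -[leLHS]ger0_norm ?sumr_ge0// => [|k _]; last by rewrite mulr_ge0 ?sqrtr_ge0.
  by rewrite -sqrtr_sqr ler_sqrt ?mulr_ge0 ?normsq_ge0// !nnE sum_CauchySchwarz.
apply: (le_trans (y := - \sum_k nn u k * nn v k)); first by rewrite lerN2.
rewrite mxE mulr_sumr Rec_sum -sumrN; apply: ler_sum => k _; rewrite !mxE.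
rewrite -sqrtrM ?addr_ge0 ?sqr_ge0//.
case: (u k 0) => a b; case: (v k 0) => c d /=.
rewrite lerNl; apply: (le_trans (ler_norm _)); rewrite -sqrtr_sqr ler_sqrt; last first.
  by rewrite mulr_ge0 // addr_ge0 ?sqr_ge0.
(* The summand is minus the imaginary part of conj(u_k) v_k, so the gap is the square of the real
   part. *)
rewrite -subr_ge0; have -> : (a ^+ 2 + b ^+ 2) * (c ^+ 2 + d ^+ 2) -
  (- (0 * (a * c - - b * d) - 1 * (a * d + - b * c))) ^+ 2 = (a * c + b * d) ^+ 2 by ring.
exact: sqr_ge0.
Qed.

Lemma evolE (R : realType) (m : nat) (Q : 'M[R[i]]_m) (mu : 'I_m -> R) (t : R) (u : 'cV[R[i]]_m) k :
  (Q ^t* *m diag_mx (\row_k cis (- t * mu k)) *m Q *m u) k 0 =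
  \sum_l ((Q l k)^* * (Q *m u) l 0) * cis (- t * mu l).
Proof.
rewrite -mulmxA mxE; apply: eq_bigr => l _.
by rewrite mul_mx_diag !mxE mulrAC.
Qed.

Section Evolution.
Variables (R : realType) (n : nat).
Local Notation m := (n * n)%N.
Variables (Q : 'M[R[i]]_m) (mu : 'I_m -> R).
Hypothesis QU : Q \is unitarymx.

Local Notation H := (Q ^t* *m diag_mx (\row_k (mu k)%:C) *m Q).
Local Notation E t := (Q ^t* *m diag_mx (\row_k cis (- t * mu k)) *m Q).

Let QQ : Q *m Q ^t* = 1%:M. Proof. exact/unitarymxP. Qed.

Lemma evolution_op (t : R) : expmx ((- 'i * t%:C) *: H) = E t.
Proof.
have -> : - 'i * t%:C = 'i * (- t)%:C by rewrite rmorphN mulrN mulNr.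
exact: expmx_spectral.
Qed.

Lemma evolution_adj (t : R) : expmx (('i * t%:C) *: H) = (E t) ^t*.
Proof.
have cisN : \row_k cis (t * mu k) = map_mx Num.Def.conjC (\row_k cis (- t * mu k)).
  apply/rowP => k; rewrite !mxE /cis mulNr cosN sinN.
  by apply/eqP; rewrite eq_complex /= opprK !eqxx.
rewrite (expmx_spectral mu t QU) cisN -map_diag_mx -[in LHS]tr_diag_mx.
by rewrite !trmx_mul !map_mxM trmxCK mulmxA.
Qed.

Lemma evolution_unitary (t : R) : (E t) ^t* *m E t = 1%:M.
Proof.
rewrite !trmx_mul !map_mxM trmxCK !mulmxA -[_ *m Q *m Q ^t*]mulmxA QQ mulmx1.
rewrite tr_diag_mx map_diag_mx -[_ *m diag_mx _ *m diag_mx _]mulmxA mulmx_diag.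
rewrite (_ : \row_i _ = const_mx 1); first by rewrite diag_const_mx mulmx1 (mulmx1C QQ).
apply/rowP => k; rewrite !mxE mulrC mulcJ /=.
by rewrite cos2Dsin2.
Qed.

Lemma evolution0 : E 0 = 1%:M.
Proof.
rewrite (_ : \row_k _ = const_mx 1); first by rewrite diag_const_mx mulmx1 (mulmx1C QQ).
by apply/rowP => k; rewrite !mxE oppr0 mul0r /cis cos0 sin0.
Qed.

Lemma evolution_mulH (chi : 'cV[R[i]]_m) l :
  (Q *m (H *m chi)) l 0 = (mu l)%:C * (Q *m chi) l 0.
Proof. by rewrite !mulmxA QQ mul1mx -mulmxA mul_diag_mx !mxE. Qed.

(** In the eigenbasis, a coordinate of [phi] with nonzero eigenvalue vanishes, and the phase of a
    zero eigenvalue is 1. *)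
Lemma evolution_fixed (phi : 'cV[R[i]]_m) (t : R) : H *m phi = 0 -> E t *m phi = phi.
Proof.
move=> Hphi; rewrite -[RHS]mul1mx -(mulmx1C QQ) -!mulmxA; congr (_ *m _).
apply/matrixP => l j; rewrite ord1 {j} mul_diag_mx [LHS]mxE mxE.
have := evolution_mulH phi l; rewrite Hphi mulmx0 mxE => /esym/eqP.
rewrite mulf_eq0 => /orP[/eqP/complexI ->|/eqP->]; last by rewrite mulr0.
by rewrite mulr0 /cis cos0 sin0 mul1r.
Qed.

Lemma rho_diag (psi : 'cV[R[i]]_m) (t : R) k :
  rho H psi t k k =
  (complex.Re ((E t *m psi) k 0) ^+ 2 + complex.Im ((E t *m psi) k 0) ^+ 2)%:C.
Proof.
have -> : rho H psi t = (E t *m psi) *m (E t *m psi) ^t*.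
  by rewrite /rho evolution_op evolution_adj [in RHS]trmx_mul map_mxM !mulmxA.
move: (E t *m psi) => y.
by rewrite mxE big_ord1 -mulcJ [(y ^t*) _ _]mxE [(y^T) _ _]mxE.
Qed.

(** Real and imaginary parts of the amplitude are both trigonometric sums, the latter after
    multiplying the coefficients by -i. *)
Lemma continuous_rho_diag (psi : 'cV[R[i]]_m) k :
  continuous (fun t => complex.Re (rho H psi t k k)).
Proof.
pose al l := (Q l k)^* * (Q *m psi) l 0.
rewrite (_ : (fun t => _) = fun t =>
  trig mu al t * trig mu al t +
  trig mu (fun l => - 'i * al l) t * trig mu (fun l => - 'i * al l) t).
  move=> t; apply: cvgD; apply: cvgM; exact: continuous_trig.
apply/funext => t; rewrite rho_diag /= -!expr2 evolE; congr (_ ^+ 2 + _ ^+ 2).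
rewrite /trig Rec_sum Imc_sum; apply: eq_bigr => l _.
have ReNi (w : R[i]) : complex.Re (- 'i * w) = complex.Im w by case: w => x y /=; ring.
by rewrite -[in RHS]mulrA ReNi.
Qed.

(** With q = (e^{-iHt} H chi)_k, the entry of the evolved state is |a phi_k + q|^2, since the
    evolution fixes phi. Dropping |q|^2 leaves a constant and the cross term 2a Re(conj(phi_k) q),
    the time derivative of 2a Re(i conj(phi_k) (e^{-iHt} chi)_k). *)
Lemma rhobar_diag_ge (phi chi : 'cV[R[i]]_m) (a T : R) k :
  H *m phi = 0 -> 0 < T ->
  a ^+ 2 * (complex.Re (phi k 0) ^+ 2 + complex.Im (phi k 0) ^+ 2) +
  2 * a / T * (complex.Re ('i * ((phi k 0)^* * (E T *m chi) k 0)) -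
               complex.Re ('i * ((phi k 0)^* * chi k 0)))
  <= complex.Re (rhobar H (a%:C *: phi + H *m chi) T k k).
Proof.
move=> Hphi T0; set n2 := _ ^+ 2 + _ ^+ 2.
pose al l := 'i * (phi k 0)^* * ((Q l k)^* * (Q *m chi) l 0).
have trigal t : trig mu al t = complex.Re ('i * ((phi k 0)^* * (E t *m chi) k 0)).
  rewrite evolE /trig mulrA mulr_sumr; congr complex.Re; apply: eq_bigr => l _.
  by rewrite /al !mulrA.
pose be l := (2 * a)%:C * al l.
have trigZ (c : R) ga t : trig mu (fun l => c%:C * ga l) t = c * trig mu ga t.
  rewrite /trig !Rec_sum mulr_sumr; apply: eq_bigr => l _.
  by rewrite -mulrA RecM /= mul0r subr0.
have dbe t := is_derive_trig mu be t.
rewrite [rhobar _ _ _ _ _]mxE /= -(ler_pM2l T0) (mulVKf (lt0r_neq0 T0)).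
have -> : T * (a ^+ 2 * n2 + 2 * a / T * (complex.Re ('i * ((phi k 0)^* * (E T *m chi) k 0)) -
    complex.Re ('i * ((phi k 0)^* * chi k 0)))) = a ^+ 2 * n2 * T + (trig mu be T - trig mu be 0).
  rewrite !trigZ !trigal evolution0 mul1mx; field; exact: lt0r_neq0.
apply: (integral_ge_FTC T0 (@continuous_rho_diag _ _) (@continuous_trig _ _ _ _) dbe) => t.
rewrite rho_diag.
have -> : (E t *m (a%:C *: phi + H *m chi)) k 0 = a%:C * phi k 0 + (E t *m (H *m chi)) k 0.
  have step (A : 'M[R[i]]_m) r : A *m phi = phi ->
      (A *m (a%:C *: phi + r)) k 0 = a%:C * phi k 0 + (A *m r) k 0.
    by move=> Aphi; rewrite mulmxDr -scalemxAr Aphi [LHS]mxE [X in X + _]mxE.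
  exact: step (evolution_fixed t Hphi).
set q := (E t *m (H *m chi)) k 0.
have -> : trig mu (fun l => - 'i * (mu l)%:C * be l) t = 2 * a * complex.Re ((phi k 0)^* * q).
  have -> : (fun l => - 'i * (mu l)%:C * be l) =
      fun l => (2 * a)%:C * ((phi k 0)^* * ((Q l k)^* * (Q *m (H *m chi)) l 0)).
    apply/funext => l; rewrite evolution_mulH /be /al.
    have i2 : - 'i * 'i = 1 :> R[i] by rewrite mulNr -expr2 sqr_i opprK.
    by rewrite -[in RHS](mul1r (mu l)%:C) -i2; ring.
  rewrite trigZ; congr (_ * _); rewrite /q evolE mulr_sumr /trig.
  by congr complex.Re; apply: eq_bigr => l _; rewrite !mulrA.
rewrite /n2; case: (phi k 0) => x y; case: q => z w /=.
rewrite -subr_ge0; set d := (X in 0 <= X).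
(* The gap is exactly the dropped square |q|^2. *)
have -> : d = z ^+ 2 + w ^+ 2 by rewrite /d; ring.
by rewrite addr_ge0 ?sqr_ge0.
Qed.

(** Of the two boundary terms, the one at time 0 vanishes by orthogonality; the one at time T is
    bounded by Cauchy-Schwarz, as the evolution preserves the norm of [chi]. *)
Lemma rhobar_sum_ge (phi chi : 'cV[R[i]]_m) (a T : R) (S : pred 'I_m) :
  let phiS := \col_k (if S k then phi k 0 else 0) in
  H *m phi = 0 -> 0 <= a -> 0 < T -> phiS ^t* *m chi = 0 ->
  a ^+ 2 * normsq phiS - 2 * a / T * Num.sqrt (normsq phiS * normsq chi) <=
  \sum_(k | S k) complex.Re (rhobar H (a%:C *: phi + H *m chi) T k k).
Proof.
move=> phiS Hphi a0 T0 phichi.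
apply: le_trans; last by apply: ler_sum => k _; exact: rhobar_diag_ge.
rewrite big_split -!mulr_sumr sumrB /=.
have sumS (v : 'cV[R[i]]_m) : \sum_(k | S k) complex.Re ('i * ((phi k 0)^* * v k 0)) =
    complex.Re ('i * (phiS ^t* *m v) 0 0).
  rewrite mxE mulr_sumr Rec_sum big_mkcond; apply: eq_bigr => k _.
  by rewrite !mxE; case: ifP => // _; rewrite rmorph0 mul0r mulr0.
rewrite !sumS phichi [(0 : 'M[R[i]]_1) 0 0]mxE mulr0 subr0; apply: lerD.
  rewrite le_eqVlt /normsq [in X in _ == X]big_mkcond; apply/orP; left; apply/eqP.
  congr (_ * _); apply: eq_bigr => k _; rewrite mxE; case: ifP => // _.
  by rewrite expr0n addr0.
rewrite -mulrN; apply: ler_wpM2l; first by rewrite divr_ge0 ?mulr_ge0// ltW.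
by rewrite -(normsq_unitary chi (evolution_unitary T)); exact: Re_form_ge.
Qed.

(** For the final comparison, since the order on [R[i]] demands equal imaginary parts. *)
Lemma rhobar_diag_real (psi : 'cV[R[i]]_m) (T : R) k :
  complex.Im (rhobar H psi T k k) = 0.
Proof.
rewrite mxE /= (@eq_Rintegral _ _ _ _ _ (cst 0)) => [|t _]; last by rewrite rho_diag.
by rewrite Rintegral_cst// mul0r mulr0.
Qed.

End Evolution.

(** * Real spectral theorem *)

Lemma mx11_norm_gt0 (R : realType) (n : nat) (u : 'rV[R]_n) : u != 0 -> 0 < (u *m u^T) 0 0.
Proof.
move=> u0; have [j uj] : exists j, u 0 j != 0 by apply/rV0Pn.
rewrite mxE (bigD1 j)//= mxE ltr_wpDr//.
  by apply: sumr_ge0 => k _; rewrite mxE -expr2 sqr_ge0.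
by rewrite -expr2 exprn_even_gt0.
Qed.

(* Project a complex eigenvector off the rows of [A], which commutes with [D], and keep
   its real or imaginary part. *)
Lemma real_eigenvector_orthogonal (R : realType) (n k : nat) (D : 'M[R]_n)
    (A : 'M[R]_(k, n)) (d : 'rV[R]_k) :
  D^T = D -> A *m A^T = 1%:M -> A *m D = diag_mx d *m A -> (k < n)%N ->
  exists (u : 'rV[R]_n) (mu : R), [/\ u *m u^T = 1%:M, u *m A^T = 0 & u *m D = mu *: u].
Proof.
move=> DT AA AD kn.
pose C := map_mx (real_complex R) D.
have CH : C ^t* = C.
  apply/matrixP => i j; rewrite !mxE -[in RHS]DT mxE.
  by apply/eqP; rewrite eq_complex /= oppr0 !eqxx.
have [Q [mu [QU CE]]] := hermitian_spectral CH.
have QQ : Q *m Q ^t* = 1%:M by apply/unitarymxP.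
have QC : Q *m C = diag_mx (\row_l (mu l)%:C) *m Q by rewrite CE !mulmxA QQ mul1mx.
pose Pr := 1%:M - A^T *m A; pose W := Q *m map_mx (real_complex R) Pr.
have DA : D *m A^T = A^T *m diag_mx d.
  by rewrite -{1}DT -trmx_mul AD trmx_mul tr_diag_mx.
have PrD : Pr *m D = D *m Pr.
  by rewrite mulmxBl mulmxBr mul1mx mulmx1 -mulmxA AD !mulmxA DA.
have PrA : Pr *m A^T = 0 by rewrite mulmxBl mul1mx -mulmxA AA mulmx1 subrr.
(* Otherwise [A^T *m A] would be the identity, of rank [n], while its rank is at most [k]. *)
have W0 : W != 0.
  apply/eqP => W0; have := congr1 (mulmx (Q ^t*)) W0.
  rewrite mulmx0 mulmxA (mulmx1C QQ) mul1mx => /eqP; rewrite map_mx_eq0 subr_eq0 => /eqP AtA.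
  have := mxrankM_maxr A^T A; rewrite -AtA mxrank1 => /leq_trans/(_ (rank_leq_row A)).
  by rewrite leqNgt kn.
have WC : W *m C = diag_mx (\row_l (mu l)%:C) *m W.
  by rewrite /W -mulmxA -map_mxM PrD map_mxM mulmxA QC mulmxA.
have WA : W *m map_mx (real_complex R) A^T = 0 by rewrite -mulmxA -map_mxM PrA map_mx0 mulmx0.
clearbody W.
have [i [j Wij]] : exists i j, W i j != 0 by apply/matrix0Pn.
(* Both choices of [f] are real-linear, so applying [f] entrywise commutes with right multiplication
   by real matrices and preserves the eigenvector equation. *)
have [f [f0 fD fZ fij]] : exists f : R[i] -> R, [/\ f 0 = 0, {morph f : x y / x + y},
    (forall x r, f (x * r%:C) = f x * r) & f (W i j) != 0].
  have : (complex.Re (W i j) != 0) || (complex.Im (W i j) != 0).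
    by rewrite -negb_and; apply: contra Wij => /andP[a b]; rewrite eq_complex a b.
  case/orP => h; [exists (@complex.Re R)|exists (@complex.Im R)]; split => //.
  - by case=> ? ? [].
  - by case=> a b r /=; rewrite mulr0 subr0.
  - by case=> ? ? [].
  - by case=> a b r /=; rewrite mulr0 add0r.
have fM p (X : 'M[R[i]]_(n, n)) (Y : 'M[R]_(n, p)) :
    map_mx f (X *m map_mx (real_complex R) Y) = map_mx f X *m Y.
  apply/matrixP => a b; rewrite !mxE (big_morph f fD f0).
  by apply: eq_bigr => c _; rewrite !mxE fZ.
pose u0 := row i (map_mx f W).
have u00 : u0 != 0 by apply/rV0Pn; exists j; rewrite !mxE.
have u0D : u0 *m D = mu i *: u0.
  rewrite -row_mul -fM WC; apply/rowP => l; rewrite [LHS]mxE mxE mul_diag_mx !mxE.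
  by rewrite mulrC fZ mulrC.
have u0A : u0 *m A^T = 0.
  by rewrite -row_mul -fM WA; apply/rowP => l; rewrite !mxE.
have nn := mx11_norm_gt0 u00; set N := (u0 *m u0^T) 0 0 in nn.
have uu : u0 *m u0^T = N%:M by apply/matrixP => a b; rewrite !ord1 [RHS]mxE eqxx mulr1n.
exists ((Num.sqrt N)^-1 *: u0), (mu i); split.
- rewrite linearZ /= -scalemxAl -scalemxAr uu scalerA scale_scalar_mx -invfM -expr2.
  by rewrite sqr_sqrtr ?ltW// mulVf ?gt_eqF.
- by rewrite -scalemxAl u0A scaler0.
- by rewrite -scalemxAl u0D !scalerA mulrC.
Qed.

(** The family grows by one row at a time; at k = n it diagonalises [D]. *)
Lemma real_orthonormal_eigenvectors (R : realType) (n : nat) (D : 'M[R]_n) :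
  D^T = D -> forall k, (k <= n)%N ->
  exists (A : 'M[R]_(k, n)) (d : 'rV[R]_k), A *m A^T = 1%:M /\ A *m D = diag_mx d *m A.
Proof.
move=> DT; elim=> [_|k IH kn].
  by exists 0, 0; split; apply/matrixP; case.
have [A [d [AA AD]]] := IH (ltnW kn).
have [u [mu [uu uA uD]]] := real_eigenvector_orthogonal DT AA AD kn.
have h1 : col_mx u A *m (col_mx u A)^T = 1%:M.
  rewrite tr_col_mx mul_col_row uu uA AA (_ : A *m u^T = 0) -?scalar_mx_block//.
  by rewrite -[A]trmxK -trmx_mul uA trmx0.
have h2 : col_mx u A *m D = diag_mx (row_mx mu%:M d) *m col_mx u A.
  rewrite mul_col_mx uD AD diag_mx_row mul_block_col !mul0mx addr0 add0r.
  suff -> : diag_mx (mu%:M : 'rV[R]_1) = mu%:M by rewrite mul_scalar_mx.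
  by apply/matrixP => a b; rewrite !ord1 !mxE eqxx.
by exists (col_mx u A), (row_mx mu%:M d).
Qed.

Lemma sort_index (R : realType) (n : nat) (d : 'I_n -> R) :
  exists s : 'I_n -> 'I_n, injective s /\
    (forall i j : 'I_n, (i <= j)%N -> d (s i) <= d (s j)).
Proof.
pose r := sort (fun i j => d i <= d j) (enum 'I_n).
have sr : size r = n by rewrite size_sort size_enum_ord.
have ur : uniq r by rewrite sort_uniq enum_uniq.
exists (fun i => nth i r i); split => [i j|i j ij].
  rewrite (set_nth_default i j) ?sr// => /eqP.
  by rewrite nth_uniq ?sr// => /eqP/val_inj.
rewrite (set_nth_default i j) ?sr//.
pose le_d (i j : 'I_n) := d i <= d j.
have tr : transitive le_d by move=> ? ? ?; exact: le_trans.
have re : reflexive le_d by move=> ?; exact: lexx.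
have sd : sorted le_d r by apply: sort_sorted => ? ?; exact: le_total.
by apply: (sorted_leq_nth tr re i sd) => //; rewrite inE sr.
Qed.

(** With eigenvectors as rows, [eigmx v *m y] lists the coordinates of [y] in the eigenbasis. *)
Definition eigmx (R : realType) (n : nat) (v : 'I_n -> 'I_n -> R) : 'M[R]_n :=
  \matrix_(i, x) v i x.

Lemma spec_dec_eigmx (R : realType) (n : nat) (D : 'M[R]_n) lam v :
  spec_dec D lam v ->
  eigmx v *m (eigmx v)^T = 1%:M /\ eigmx v *m D = diag_mx (\row_i lam i) *m eigmx v.
Proof.
move=> [vv [-> _]].
have BB : eigmx v *m (eigmx v)^T = 1%:M.
  apply/matrixP => i j; rewrite !mxE -vv; apply: eq_bigr => x _; by rewrite !mxE.
split => //.
have -> : \sum_i lam i *: \matrix_(x, y) (v i x * v i y) =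
    (eigmx v)^T *m diag_mx (\row_i lam i) *m eigmx v.
  apply/matrixP => x y; rewrite summxE mxE; apply: eq_bigr => i _.
  by rewrite mul_mx_diag !mxE; ring.
by rewrite !mulmxA BB mul1mx.
Qed.

(** The form inequality bounds all eigenvalues by 1, its equality case makes the eigenvalue 1
    simple, and [e] shows that 1 occurs. Sorting then puts it at the top index. *)
Lemma spec_dec_exists (R : realType) (n : nat) (D : 'M[R]_n) (e : 'cV[R]_n) :
  D^T = D -> e != 0 -> D *m e = e ->
  (forall q : 'cV[R]_n, (q^T *m D *m q) 0 0 <= (q^T *m q) 0 0) ->
  (forall q : 'cV[R]_n, (q^T *m D *m q) 0 0 = (q^T *m q) 0 0 -> exists c, q = c *: e) ->
  exists lam v, spec_dec D lam v.
Proof.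
move=> DT e0 De Dle Deq.
have [A [d [AA AD]]] := real_orthonormal_eigenvectors DT (leqnn n).
have [s [sI smono]] := sort_index (fun i => d 0 i).
pose lam i := d 0 (s i); pose v i x := A (s i) x.
pose b i : 'cV[R]_n := (row (s i) A)^T.
have bb i j : ((b i)^T *m b j) 0 0 = (i == j)%:R.
  rewrite trmxK -row_mul; have /matrixP/(_ (s i) (s j)) := AA.
  rewrite !mxE (inj_eq sI) => <-; apply: eq_bigr => x _; by rewrite !mxE.
have Db i : D *m b i = lam i *: b i.
  rewrite /b -{1}DT -trmx_mul -row_mul AD mul_diag_mx; apply/matrixP => x y.
  by rewrite !mxE.
have bDb i : ((b i)^T *m D *m b i) 0 0 = lam i.
  by rewrite -mulmxA Db -scalemxAr mxE bb eqxx mulr1.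
have lam1 i : lam i <= 1 by have := Dle (b i); rewrite bDb bb eqxx.
(* Both eigenvectors are multiples of [e]; were they orthogonal, one of them would be zero, against
   unit norm. *)
have uniq1 i j : lam i = 1 -> lam j = 1 -> i = j.
  move=> li lj; have [ci bi] : exists c, b i = c *: e by apply: Deq; rewrite bDb bb eqxx.
  have [cj bj] : exists c, b j = c *: e by apply: Deq; rewrite bDb bb eqxx.
  apply/eqP/negPn/negP => nij; have := bb i j; rewrite (negbTE nij).
  have form x y : ((x *: e)^T *m (y *: e)) 0 0 = x * y * (e^T *m e) 0 0.
    by rewrite [(x *: e)^T]linearZ /= -scalemxAr -scalemxAl scalerA [LHS]mxE [y * x]mulrC.
  have := bb i i; have := bb j j; rewrite !eqxx bi bj !form.
  move=> hj hi /eqP; rewrite !mulf_eq0 => /orP[/orP[]|] /eqP h.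
  - by move: hi; rewrite h !mul0r => /eqP; rewrite eq_sym oner_eq0.
  - by move: hj; rewrite h !mul0r => /eqP; rewrite eq_sym oner_eq0.
  - by move: hj; rewrite h !mulr0 => /eqP; rewrite eq_sym oner_eq0.
(* Some eigencoordinate of [e] is nonzero, and [D *m e = e] forces the eigenvalue there to be 1. *)
have [i1 li1] : exists i, lam i = 1.
  have Ae0 : A *m e != 0.
    by apply: contra e0 => /eqP h; rewrite -[e]mul1mx -(mulmx1C AA) -mulmxA h mulmx0.
  have [k hk] : exists k, (A *m e) k 0 != 0 by case/cV0Pn: Ae0 => k hk; exists k.
  have [s' sK s'K] := injF_bij sI; exists (s' k); rewrite /lam s'K.
  have /matrixP/(_ k 0) := congr1 (fun X => X *m e) AD.
  rewrite -mulmxA De -mulmxA mul_diag_mx [RHS]mxE => h.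
  by apply: (mulIf hk); rewrite mul1r -h.
exists lam, v; split.
  move=> i j; rewrite -bb mxE; apply: eq_bigr => x _; by rewrite !mxE.
split.
  apply/matrixP => x y; rewrite summxE.
  transitivity ((A^T *m (A *m D)) x y); first by rewrite mulmxA (mulmx1C AA) mul1mx.
  rewrite AD mxE (reindex_inj sI); apply: eq_bigr => i _.
  by rewrite mul_diag_mx !mxE mulrCA.
have top (i : 'I_n) : val i = n.-1 -> lam i = 1.
  move=> hi; apply/eqP; rewrite eq_le lam1 -li1; apply: smono.
  by rewrite -[nat_of_ord i]/(val i) hi -ltnS prednK// (leq_trans _ (ltn_ord i)).
split => //; split => // i hi.
rewrite lt_neqAle lam1 andbT; apply/eqP => li.
have n0 : (n.-1 < n)%N by rewrite prednK// (leq_trans _ (ltn_ord i)).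
have := uniq1 i (Ordinal n0) li (top (Ordinal n0) erefl) => E.
by move: hi; rewrite E ltnn.
Qed.

(** * Hitting times as Poisson forms *)

Lemma eigmx_1B (R : realType) (n : nat) (D : 'M[R]_n) lam v (y : 'cV[R]_n) i :
  spec_dec D lam v ->
  (eigmx v *m ((1%:M - D) *m y)) i 0 = (1 - lam i) * (eigmx v *m y) i 0.
Proof.
move=> /spec_dec_eigmx[_ BD].
rewrite mulmxBl mul1mx mulmxBr mulmxA BD -mulmxA [LHS]mxE.
by rewrite [X in _ + X]mxE mul_diag_mx [X in _ - X]mxE !mxE mulrBl mul1r.
Qed.

Lemma eigmx_fixed (R : realType) (n : nat) (D : 'M[R]_n) lam v (e : 'cV[R]_n) (i : 'I_n) :
  spec_dec D lam v -> D *m e = e -> (i < n.-1)%N -> (eigmx v *m e) i 0 = 0.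
Proof.
move=> sd De i_lt; have := eigmx_1B e i sd.
rewrite mulmxBl mul1mx De subrr mulmx0 [in LHS]mxE => /esym/eqP.
have [_ [_ [_ [lam_lt _]]]] := sd.
by rewrite mulf_eq0 subr_eq0 eq_sym lt_eqF ?lam_lt//= => /eqP.
Qed.

Lemma HT_ofE (R : realType) (n : nat) lam v (u : 'cV[R]_n) :
  HT_of lam v (fun x => u x 0) =
  \sum_(j < n | (j < n.-1)%N) ((eigmx v *m u) j 0) ^+ 2 / (1 - lam j).
Proof.
apply: eq_bigr => j _; congr (_ ^+ 2 / _); rewrite mxE.
by apply: eq_bigr => x _; rewrite mxE.
Qed.

(** A fixed vector has only a top eigencoordinate, which the sum omits. Hence |U> may be replaced by
    its component orthogonal to the stationary direction. *)
Lemma HT_of_shift (R : realType) (n : nat) (D : 'M[R]_n) lam v (e g : 'cV[R]_n) c :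
  spec_dec D lam v -> D *m e = e ->
  HT_of lam v (fun x => (g + c *: e) x 0) = HT_of lam v (fun x => g x 0).
Proof.
move=> sd De; rewrite !HT_ofE; apply: eq_bigr => j jn.
rewrite mulmxDr -scalemxAr; congr (_ ^+ 2 / _).
by rewrite [LHS]mxE [X in _ + X]mxE (eigmx_fixed sd De jn) mulr0 addr0.
Qed.

Lemma form_eigmx (R : realType) (n : nat) (D : 'M[R]_n) lam v (y g : 'cV[R]_n) :
  spec_dec D lam v ->
  (y^T *m g) 0 0 = \sum_i (eigmx v *m y) i 0 * (eigmx v *m g) i 0.
Proof.
move=> /spec_dec_eigmx[BB _].
transitivity (((eigmx v *m y)^T *m (eigmx v *m g)) 0 0).
  by rewrite trmx_mul mulmxA -[_ *m _ *m eigmx v]mulmxA (mulmx1C BB) mulmx1.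
by rewrite mxE; apply: eq_bigr => i _; rewrite [_^T _ _]mxE.
Qed.

Lemma ord_lt_pred (n : nat) (i : 'I_n) : (i < n.-1)%N = (val i != n.-1).
Proof. by case: n i => [[]//|n] i /=; rewrite ltn_neqAle -ltnS ltn_ord andbT. Qed.

(** Eigencoordinates of [g] are those of [y] times 1 - lam_j, and the top one is zero. Any solution
    of the Poisson equation thus evaluates the hitting time. *)
Lemma HT_of_poisson (R : realType) (n : nat) (D : 'M[R]_n) lam v (y g : 'cV[R]_n) :
  spec_dec D lam v -> (1%:M - D) *m y = g ->
  HT_of lam v (fun x => g x 0) = (y^T *m g) 0 0.
Proof.
move=> sd Dy; have [_ [_ [top [lam_lt _]]]] := sd.
rewrite HT_ofE (form_eigmx _ _ sd) [RHS](bigID (fun j : 'I_n => (j < n.-1)%N)) /=.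
rewrite [X in _ = _ + X]big1 ?addr0 => [|i]; last first.
  by rewrite ord_lt_pred negbK -Dy (eigmx_1B _ _ sd) => /eqP/top ->; rewrite subrr mul0r mulr0.
apply: eq_bigr => j jn; rewrite -Dy (eigmx_1B _ _ sd).
have := lam_lt j jn; rewrite -subr_gt0 => /lt0r_neq0 h; field; exact: h.
Qed.

(** The equation is solved in the eigenbasis by dividing by 1 - lam_i^2. Nonnegative eigenvalues
    give 1 - lam_i^2 >= 1 - lam_i, so the form is dominated termwise. *)
Lemma poisson_sq (R : realType) (n : nat) (D : 'M[R]_n) lam v (e g : 'cV[R]_n) :
  spec_dec D lam v -> (forall i, 0 <= lam i) -> e != 0 -> D *m e = e ->
  (e^T *m g) 0 0 = 0 ->
  exists w : 'cV[R]_n, (1%:M - D *m D) *m w = g /\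
    (w^T *m g) 0 0 <= HT_of lam v (fun x => g x 0).
Proof.
move=> sd lam0 e0 De eg; have [_ [_ [top [lam_lt _]]]] := sd.
have [BB BD] := spec_dec_eigmx sd.
set B := eigmx v in BB BD *.
have lt_top (i : 'I_n) : (i < n.-1)%N = false -> forall j : 'I_n, (j < n.-1)%N = false -> i = j.
  rewrite ord_lt_pred => /negbFE/eqP hi j; rewrite ord_lt_pred => /negbFE/eqP hj.
  by apply: val_inj; rewrite hi hj.
(* [e] lives on the top coordinate alone, so orthogonality to [e] kills that coordinate of [g]. *)
have Bg_top (i : 'I_n) : (i < n.-1)%N = false -> (B *m g) i 0 = 0.
  move=> hi; have Bei : (B *m e) i 0 != 0.
    apply: contra e0 => /eqP h; rewrite -[e]mul1mx -(mulmx1C BB) -mulmxA.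
    suff -> : B *m e = 0 by rewrite mulmx0.
    apply/matrixP => j k; rewrite ord1 [RHS]mxE; case: (boolP (j < n.-1)%N) => hj.
      exact: eigmx_fixed sd De hj.
    by rewrite -(lt_top _ hi j (negbTE hj)).
  move: eg; rewrite (form_eigmx _ _ sd) (bigD1 i)//= big1 ?addr0 => [/eqP|j ji].
    by rewrite mulf_eq0 (negbTE Bei) => /eqP.
  case: (boolP (j < n.-1)%N) => hj; first by rewrite (eigmx_fixed sd De hj) mul0r.
  by move: ji; rewrite -(lt_top _ hi j (negbTE hj)) eqxx.
(* At the top index the divisor would be zero; the value 0 is consistent because [g] vanishes
   there. *)
pose z : 'cV[R]_n := \col_i (if (i < n.-1)%N then (B *m g) i 0 / (1 - lam i ^+ 2) else 0).
have lam2 (i : 'I_n) : (i < n.-1)%N -> 0 < 1 - lam i ^+ 2.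
  by move=> hi; rewrite subr_gt0 expr_lt1// lam_lt.
have Bw : B *m (B^T *m z) = z by rewrite mulmxA BB mul1mx.
have BDD : B *m (D *m D) = diag_mx (\row_i lam i ^+ 2) *m B.
  rewrite mulmxA BD -mulmxA BD mulmxA mulmx_diag; congr (diag_mx _ *m _).
  by apply/rowP => i; rewrite !mxE expr2.
have injB (x y : 'cV[R]_n) : B *m x = B *m y -> x = y.
  by move=> /(congr1 (mulmx B^T)); rewrite !mulmxA (mulmx1C BB) !mul1mx.
exists (B^T *m z); split.
  apply: injB; rewrite mulmxBl mul1mx mulmxBr Bw mulmxA BDD -mulmxA Bw mul_diag_mx.
  apply/matrixP => i j; rewrite ord1 [LHS]mxE [X in _ + X]mxE [X in _ - X]mxE.
  rewrite ![z i _]mxE [(\row__ _) _ _]mxE.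
  case: (boolP (i < n.-1)%N) => hi; last by rewrite Bg_top ?(negbTE hi)// mulr0 subrr.
  by field; exact: lt0r_neq0 (lam2 i hi).
rewrite HT_ofE (form_eigmx _ _ sd) -/B Bw [leRHS]big_mkcond.
apply: ler_sum => i _; rewrite [z i _]mxE; case: ifPn => hi; last by rewrite mul0r.
rewrite mulrAC -expr2; apply: ler_wpM2l; first exact: sqr_ge0.
have l1 := lam_lt i hi; rewrite lef_pV2 ?posrE ?lam2 ?subr_gt0//.
by rewrite lerB// expr2 ler_piMr// ltW.
Qed.

(** * Discriminants of reversible chains *)

Lemma stationary_expr (R : realType) (n : nat) (P : 'M[R]_n) (pi : 'I_n -> R) k y :
  stationary P pi -> \sum_x pi x * (P ^+ k) x y = pi y.
Proof.
move=> [_ [_ st]]; elim: k y => [|k IH] y.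
  rewrite (bigD1 y)//= big1 ?addr0 => [|x xy]; first by rewrite expr0 mxE eqxx mulr1.
  by rewrite expr0 mxE (negbTE xy) mulr0.
rewrite -[RHS]st; under [RHS]eq_bigr => x _ do rewrite -IH mulr_suml.
rewrite exchange_big; apply: eq_bigr => x _ /=.
by rewrite exprSr -mulmxE mxE mulr_sumr; apply: eq_bigr => z _; rewrite mulrA.
Qed.

Lemma exprmx_ge0 (R : realType) (n : nat) (P : 'M[R]_n) k :
  (forall x y, 0 <= P x y) -> forall x y, 0 <= (P ^+ k) x y.
Proof.
move=> P0; elim: k => [|k IH] x y; first by rewrite expr0 mxE ler0n.
by rewrite exprS -mulmxE mxE; apply: sumr_ge0 => z _; rewrite mulr_ge0.
Qed.

Lemma stationary_gt0 (R : realType) (n : nat) (P : 'M[R]_n) (pi : 'I_n -> R) :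
  stochastic P -> irreducible P -> stationary P pi -> forall x, 0 < pi x.
Proof.
move=> [P0 _] irr st y; have [pi0 [pi1 _]] := st.
have [x pix] : exists x, 0 < pi x.
  apply/not_existsP => h; have : \sum_x pi x = 0.
    by apply: big1 => x _; apply/eqP; rewrite eq_le pi0 andbT leNgt; apply/negP/h.
  by rewrite pi1 => /eqP; rewrite oner_eq0.
have [k pk] := irr x y; rewrite -(stationary_expr k y st) (bigD1 x)//=.
by rewrite ltr_wpDr ?mulr_gt0// sumr_ge0// => z _; rewrite mulr_ge0// exprmx_ge0.
Qed.

Lemma irreducible_const (R : realType) (n : nat) (P : 'M[R]_n) (h : 'I_n -> R) :
  (forall x y, 0 <= P x y) -> irreducible P ->
  (forall x y, 0 < P x y -> h x = h y) -> forall x y, h x = h y.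
Proof.
move=> P0 irr hP x y; have [k] := irr x y; elim: k x => [|k IH] x.
  by rewrite expr0 mxE; case: eqP => [->//|_]; rewrite ltxx.
rewrite exprS -mulmxE mxE => pk.
have [z Pz] : exists z, 0 < P x z * (P ^+ k) z y.
  apply/not_existsP => hz; move: pk; rewrite big1 ?ltxx// => z _.
  by apply/eqP; rewrite eq_le mulr_ge0 ?exprmx_ge0// andbT leNgt; apply/negP/hz.
have Pk0 := exprmx_ge0 k P0 z y.
have Pxz : 0 < P x z.
  by rewrite lt_neqAle P0 andbT eq_sym; apply: contraTneq Pz => ->; rewrite mul0r ltxx.
rewrite (hP _ _ Pxz); apply: IH.
by rewrite lt_neqAle Pk0 andbT eq_sym; apply: contraTneq Pz => ->; rewrite mulr0 ltxx.
Qed.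

(** c = -1 gives the Dirichlet form, behind D <= 1; c = 1 gives its signless counterpart, behind D
    >= 0. *)
Lemma reversible_form (R : realType) (n : nat) (K : 'M[R]_n) (pi h : 'I_n -> R) (c : R) :
  stochastic K -> reversible K pi -> c ^+ 2 = 1 ->
  \sum_x \sum_y pi x * K x y * (h x + c * h y) ^+ 2 =
  2 * (\sum_x pi x * h x ^+ 2 + c * \sum_x \sum_y pi x * K x y * (h x * h y)).
Proof.
move=> [_ K1] rev c2.
have e1 : \sum_x pi x * h x ^+ 2 = \sum_x \sum_y pi x * K x y * h x ^+ 2.
  apply: eq_bigr => x _; rewrite -mulr_suml -mulr_sumr K1; ring.
have e2 : \sum_x pi x * h x ^+ 2 = \sum_x \sum_y pi x * K x y * h y ^+ 2.
  rewrite exchange_big e1; apply: eq_bigr => x _; apply: eq_bigr => y _ /=.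
  by rewrite rev.
rewrite mulrDr mulrDl mul1r {1}e1 e2 !mulr_sumr -!big_split; apply: eq_bigr => x _ /=.
rewrite !mulr_sumr -!big_split; apply: eq_bigr => y _ /=.
have -> : (h x + c * h y) ^+ 2 = h x ^+ 2 + c ^+ 2 * h y ^+ 2 + 2 * c * (h x * h y) by ring.
rewrite c2; ring.
Qed.

Definition sqrt_col (R : realType) (n : nat) (pi : 'I_n -> R) : 'cV[R]_n :=
  \col_x Num.sqrt (pi x).

Section Discriminant.
Variables (R : realType) (n : nat) (P : 'M[R]_n) (pi : 'I_n -> R).
Hypotheses (lazyP : lazy_chain P) (stP : stochastic P) (irrP : irreducible P).
Hypotheses (pi_gt0 : forall x, 0 < pi x) (revP : reversible P pi).

Let sq_gt0 x : 0 < Num.sqrt (pi x). Proof. by rewrite sqrtr_gt0. Qed.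
Let sq_neq0 x : Num.sqrt (pi x) != 0. Proof. by rewrite gt_eqF. Qed.
Let sq2 x : Num.sqrt (pi x) ^+ 2 = pi x. Proof. by rewrite sqr_sqrtr// ltW. Qed.

(** Detailed balance makes the discriminant similar to [P] through the diagonal matrix of the
    sqrt(pi_x). *)
Lemma discr_reversibleE x y :
  discr P x y = Num.sqrt (pi x) * P x y / Num.sqrt (pi y).
Proof.
have [P0 _] := stP.
rewrite mxE; apply: (@pexpIrn _ 2) => //; rewrite ?nnegrE ?sqrtr_ge0//.
  by rewrite divr_ge0 ?mulr_ge0// ltW.
rewrite sqr_sqrtr ?mulr_ge0// !exprMn exprVn !sq2.
have -> : P y x = pi x * P x y / pi y by rewrite revP mulrAC divff ?mul1r ?gt_eqF.
ring.
Qed.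

Lemma discr_tr : (discr P)^T = discr P.
Proof. by apply/matrixP => x y; rewrite !mxE mulrC. Qed.

Lemma discr_sqrt_col : discr P *m sqrt_col pi = sqrt_col pi.
Proof.
have [_ P1] := stP.
apply/matrixP => x j; rewrite !mxE.
under eq_bigr => y _ do rewrite discr_reversibleE mxE mulfVK//.
by rewrite -mulr_sumr P1 mulr1.
Qed.

Let formE (q : 'cV[R]_n) (h := fun x => q x 0 / Num.sqrt (pi x)) :
  (q^T *m q) 0 0 = \sum_x pi x * h x ^+ 2 /\
  (q^T *m discr P *m q) 0 0 = \sum_x \sum_y pi x * P x y * (h x * h y).
Proof.
split.
  rewrite mxE; apply: eq_bigr => x _; rewrite mxE /h exprMn exprVn sq2.
  by field; rewrite gt_eqF.
rewrite -mulmxA mxE; apply: eq_bigr => x _; rewrite !mxE mulr_sumr.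
apply: eq_bigr => y _; rewrite discr_reversibleE /h -[X in _ = X * _ * _](sq2 x).
by field; rewrite !sq_neq0.
Qed.

Let dirichlet (q : 'cV[R]_n) (h := fun x => q x 0 / Num.sqrt (pi x)) :
  2 * ((q^T *m q) 0 0 - (q^T *m discr P *m q) 0 0) =
  \sum_x \sum_y pi x * P x y * (h x - h y) ^+ 2.
Proof.
have [-> ->] := formE q.
rewrite -[X in 2 * (X - _)]/(\sum_x pi x * h x ^+ 2) -mulN1r.
rewrite -(@reversible_form _ _ P pi h (-1))//; last by rewrite sqrrN expr1n.
by apply: eq_bigr => x _; apply: eq_bigr => y _; rewrite mulN1r.
Qed.

Let dirichlet_term_ge0 (h : 'I_n -> R) x y : 0 <= pi x * P x y * (h x - h y) ^+ 2.
Proof. by have [P0 _] := stP; rewrite mulr_ge0 ?sqr_ge0// mulr_ge0// ltW. Qed.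

Lemma discr_form_le (q : 'cV[R]_n) : (q^T *m discr P *m q) 0 0 <= (q^T *m q) 0 0.
Proof.
rewrite -subr_ge0 -(@pmulr_rge0 _ 2)// dirichlet.
apply: sumr_ge0 => x _; apply: sumr_ge0 => y _.
exact: (dirichlet_term_ge0 (fun x => q x 0 / Num.sqrt (pi x))).
Qed.

(** Equality makes the Dirichlet form vanish, so q_x / sqrt(pi_x) is constant along positive
    transitions, hence everywhere by irreducibility. *)
Lemma discr_form_eq (q : 'cV[R]_n) :
  (q^T *m discr P *m q) 0 0 = (q^T *m q) 0 0 -> exists c, q = c *: sqrt_col pi.
Proof.
move=> qq; have [P0 _] := stP.
pose h x := q x 0 / Num.sqrt (pi x).
have s0 : \sum_x \sum_y pi x * P x y * (h x - h y) ^+ 2 = 0.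
  by rewrite -(dirichlet q) qq subrr mulr0.
have t0 x : 0 <= \sum_y pi x * P x y * (h x - h y) ^+ 2.
  by apply: sumr_ge0 => y _; exact: dirichlet_term_ge0.
have hP x y : 0 < P x y -> h x = h y.
  move=> Pxy; have := psumr_eq0P (fun x _ => t0 x) s0 isT.
  move=> /(_ x) /(psumr_eq0P (fun y _ => dirichlet_term_ge0 h x y)) /(_ y isT) /eqP.
  by rewrite mulf_eq0 sqrf_eq0 mulf_eq0 (gt_eqF (pi_gt0 x)) (gt_eqF Pxy) subr_eq0 => /eqP.
have hc := irreducible_const P0 irrP hP.
case: (pickP (fun x : 'I_n => true)) => [x0 _|no]; last first.
  by exists 0; apply/matrixP => x; have := no x.
exists (h x0); apply/matrixP => x j; rewrite ord1 !mxE (hc x0 x) /h.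
by rewrite mulfVK.
Qed.

(** Laziness, P = (1 + K)/2, writes the form as a quarter of the sum of pi_x K_xy (h_x + h_y)^2. *)
Lemma discr_form_ge0 (q : 'cV[R]_n) : 0 <= (q^T *m discr P *m q) 0 0.
Proof.
have [K [stK PK]] := lazyP; have [K0 _] := stK.
have revK : reversible K pi.
  move=> x y; have := revP x y; rewrite PK !mxE.
  by case: eqVneq => [->//|] _ /=; rewrite !add0r => h; lra.
have [_ ->] := formE q; pose h x := q x 0 / Num.sqrt (pi x); rewrite -/h.
suff -> : \sum_x \sum_y pi x * P x y * (h x * h y) =
  4^-1 * (\sum_x \sum_y pi x * K x y * (h x + 1 * h y) ^+ 2).
  rewrite mulr_ge0 ?invr_ge0//; apply: sumr_ge0 => x _; apply: sumr_ge0 => y _.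
  by rewrite mulr_ge0 ?sqr_ge0// mulr_ge0// ltW.
rewrite reversible_form ?expr1n// mul1r mulrA (_ : 4^-1 * 2 = 2^-1); last by field.
rewrite -big_split mulr_sumr; apply: eq_bigr => x _ /=.
rewrite PK; under eq_bigr => y _ do rewrite !mxE.
rewrite (bigD1 x)//= [X in _ = _ * (_ + X)](bigD1 x)//= eqxx mulrDr.
have -> : \sum_(i < n | i != x) pi x * (2^-1 * ((x == i)%:R + K x i)) * (h x * h i) =
  2^-1 * \sum_(i < n | i != x) pi x * K x i * (h x * h i).
  rewrite mulr_sumr; apply: eq_bigr => y xy; rewrite eq_sym (negbTE xy) /=; ring.
rewrite /=; ring.
Qed.

End Discriminant.

(** * The interpolated chain *)

Lemma mx11_sum (R : realType) (n : nat) (u v : 'cV[R]_n) :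
  (u^T *m v) 0 0 = \sum_x u x 0 * v x 0.
Proof. by rewrite mxE; apply: eq_bigr => x _; rewrite mxE. Qed.

Section Interpolation.
Variables (R : realType) (n : nat) (P : 'M[R]_n) (pi : 'I_n -> R) (M : {set 'I_n}).
Hypotheses (lazyP : lazy_chain P) (stP : stochastic P) (irrP : irreducible P).
Hypotheses (pi_gt0 : forall x, 0 < pi x) (revP : reversible P pi) (pi1 : \sum_x pi x = 1).
Hypotheses (M0 : M != finset.set0) (pM2 : pM pi M <= 2^-1).

Local Notation p := (pM pi M).
Local Notation D s := (discr (interp P M s)).

Lemma pM_gt0 : 0 < p.
Proof.
have /set0Pn[x xM] := M0; rewrite /pM (bigD1 x)//= ltr_wpDr// sumr_ge0// => y _.
exact: ltW.
Qed.

Lemma pMC : \sum_(x | x \notin M) pi x = 1 - p.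
Proof. by rewrite -pi1 [X in X - _](bigID (mem M))/= [RHS]addrC addKr. Qed.

Definition scale_row (s : R) : 'rV[R]_n := \row_x (if x \in M then Num.sqrt (1 - s) else 1).

Local Notation G s := (diag_mx (scale_row s)).

(** Off the diagonal, interpolation multiplies rows in M by 1 - s, so the geometric mean gains
    sqrt(1 - s) for each endpoint in M. On the diagonal, 1 - p_xx(s) = (1 - s)(1 - p_xx) for x in
    M. *)
Lemma interp_discr s : 0 <= s -> s <= 1 -> 1%:M - D s = G s *m (1%:M - discr P) *m G s.
Proof.
move=> s0 s1; have [P0 _] := stP.
have s1' : 0 <= 1 - s by rewrite subr_ge0.
have sq2 := sqr_sqrtr s1'.
apply/matrixP => x y; rewrite mul_mx_diag [RHS]mxE mul_diag_mx !mxE.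
case: (boolP (x \in M)) => xM; case: (boolP (y \in M)) => yM.
- rewrite [y == x]eq_sym; case: (eqVneq x y) => [<-|xy] /=; last first.
    rewrite !mulr0 !addr0 !sub0r mulrACA -expr2 sqrtrM ?sqr_ge0// sqrtr_sqr ger0_norm//.
    by rewrite -[in LHS]sq2 expr2; ring.
  rewrite -!expr2 !sqrtr_sqr !ger0_norm ?addr_ge0 ?mulr_ge0//.
  by rewrite mulrAC -expr2 sq2; ring.
- have -> : (x == y) = false by apply: contraNF yM => /eqP <-.
  rewrite mulr0 addr0 -mulrDl subrK mul1r mulr1 !sub0r -mulrA sqrtrM//; ring.
- have -> : (x == y) = false by apply: contraNF xM => /eqP ->.
  rewrite (_ : (y == x) = false); last by apply: contraNF xM => /eqP <-.
  rewrite mulr0 addr0 -mulrDl subrK mul1r mul1r !sub0r mulrCA sqrtrM//; ring.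
- by rewrite -!mulrDl !subrK !mul1r mulr1.
Qed.

Lemma scale_row_gt0 s x : s < 1 -> 0 < scale_row s 0 x.
Proof. by move=> s1; rewrite mxE; case: ifP => // _; rewrite sqrtr_gt0 subr_gt0. Qed.

Definition scale_row_inv (s : R) : 'rV[R]_n := \row_x (scale_row s 0 x)^-1.
Local Notation G' s := (diag_mx (scale_row_inv s)).

Lemma scaleK s : s < 1 -> G s *m G' s = 1%:M.
Proof.
move=> s1; rewrite mulmx_diag (_ : \row_i _ = const_mx 1) ?diag_const_mx//.
apply/rowP => x; rewrite mxE [scale_row_inv _ _ _]mxE [RHS]mxE divff//.
by rewrite gt_eqF// scale_row_gt0.
Qed.

Lemma scaleVK s : s < 1 -> G' s *m G s = 1%:M.
Proof. by move=> s1; rewrite diag_mxC scaleK. Qed.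

(* Unnormalised stationary amplitudes of [interp P M s]. *)
Definition stat_col (s : R) : 'cV[R]_n :=
  \col_x ((if x \in M then 1 else Num.sqrt (1 - s)) * Num.sqrt (pi x)).

Lemma scale_stat_col s : G s *m stat_col s = Num.sqrt (1 - s) *: sqrt_col pi.
Proof.
by apply/matrixP => x j; rewrite mul_diag_mx !mxE; case: ifP => _; rewrite ?mul1r.
Qed.

Lemma stat_col_neq0 s : stat_col s != 0.
Proof.
have /set0Pn[x xM] := M0; apply/cV0Pn; exists x.
by rewrite mxE xM mul1r gt_eqF// sqrtr_gt0.
Qed.

Lemma interp_stat_col s : 0 <= s -> s <= 1 -> D s *m stat_col s = stat_col s.
Proof.
move=> s0 s1; apply/eqP; rewrite eq_sym -subr_eq0 -[X in X - _]mul1mx -mulmxBl.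
rewrite interp_discr// -!mulmxA scale_stat_col -!scalemxAr mulmxBl mul1mx.
by rewrite (discr_sqrt_col stP pi_gt0 revP) subrr mulmx0 scaler0.
Qed.

Let formB s (q : 'cV[R]_n) : 0 <= s -> s <= 1 ->
  (q^T *m q) 0 0 - (q^T *m D s *m q) 0 0 =
  ((G s *m q)^T *m (G s *m q)) 0 0 - ((G s *m q)^T *m discr P *m (G s *m q)) 0 0.
Proof.
move=> s0 s1.
transitivity ((q^T *m (1%:M - D s) *m q) 0 0).
  by rewrite mulmxBr mulmxBl mulmx1 [RHS]mxE [X in _ = _ + X]mxE.
rewrite interp_discr// trmx_mul tr_diag_mx.
transitivity ((q^T *m G s *m (1%:M - discr P) *m (G s *m q)) 0 0); first by rewrite !mulmxA.
by rewrite mulmxBr mulmxBl mulmx1 [LHS]mxE [X in _ + X]mxE.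
Qed.

Lemma interp_form_le s (q : 'cV[R]_n) : 0 <= s -> s <= 1 ->
  (q^T *m D s *m q) 0 0 <= (q^T *m q) 0 0.
Proof.
by move=> s0 s1; rewrite -subr_ge0 formB// subr_ge0; exact: discr_form_le.
Qed.

(** By the congruence the form equals |q|^2 - |Gq|^2 + <Gq, D(P) Gq>, and [G s] is a contraction. *)
Lemma interp_form_ge0 s (q : 'cV[R]_n) : 0 <= s -> s <= 1 ->
  0 <= (q^T *m D s *m q) 0 0.
Proof.
move=> s0 s1; have := formB q s0 s1.
have := discr_form_ge0 lazyP stP pi_gt0 revP (G s *m q).
have : ((G s *m q)^T *m (G s *m q)) 0 0 <= (q^T *m q) 0 0.
  rewrite !mx11_sum; apply: ler_sum => x _; rewrite mul_diag_mx !mxE.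
  case: ifP => _; rewrite ?mul1r// mulrACA -!expr2 sqr_sqrtr ?subr_ge0//.
  by rewrite ler_piMl ?sqr_ge0// lerBlDr lerDl.
lra.
Qed.

(** Simplicity of the eigenvalue 1 transfers from [discr P] because [G s] is invertible for s < 1.
    Existence matters: HT(s) is specified only through given decompositions. *)
Lemma interp_spec_dec s : 0 <= s -> s < 1 -> exists lam v, spec_dec (D s) lam v.
Proof.
move=> s0 s1; have s1' := ltW s1.
apply: (spec_dec_exists (e := stat_col s)).
- exact: discr_tr.
- exact: stat_col_neq0.
- exact: interp_stat_col.
- by move=> q; exact: interp_form_le.
move=> q qq; have := formB q s0 s1'; rewrite qq subrr => /esym/eqP; rewrite subr_eq0 => /eqP/esym.
move=> /(discr_form_eq stP irrP pi_gt0 revP)[c Gq].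
have sq0 : Num.sqrt (1 - s) != 0 by rewrite gt_eqF// sqrtr_gt0 subr_gt0.
exists (c / Num.sqrt (1 - s)); rewrite -[q]mul1mx -(scaleVK s1) -mulmxA Gq.
have -> : sqrt_col pi = (Num.sqrt (1 - s))^-1 *: (G s *m stat_col s).
  by rewrite scale_stat_col scalerA mulVf// scale1r.
by rewrite scalerA -scalemxAr mulmxA scaleVK// mul1mx.
Qed.

Lemma interp_lam_ge0 s lam v : 0 <= s -> s < 1 -> spec_dec (D s) lam v -> forall i, 0 <= lam i.
Proof.
move=> s0 s1 sd i; have [BB BD] := spec_dec_eigmx sd.
have := interp_form_ge0 (row i (eigmx v))^T s0 (ltW s1).
rewrite trmxK -row_mul BD.
suff -> : (row i (diag_mx (\row_i lam i) *m eigmx v) *m (row i (eigmx v))^T) 0 0 = lam i by [].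
have := BB => /matrixP/(_ i i); rewrite [X in _ = X]mxE eqxx mxE => h.
rewrite mul_diag_mx mxE -[RHS]mulr1 -[X in _ = _ * X]h mulr_sumr; apply: eq_bigr => x _.
by rewrite !mxE mulrA.
Qed.

(** The squared norm of [stat_col s]. *)
Local Notation N s := (p + (1 - s) * (1 - p)).

(* [source_col s] is the component of |U> orthogonal to [stat_col s]; since
   [1 - D s = G s (1 - discr P) G s], it depends on [s] only through [G s] and a scalar. *)
Definition source0 : 'cV[R]_n :=
  \col_x ((if x \in M then - (Num.sqrt (1 - p) / p) else (Num.sqrt (1 - p))^-1)
           * Num.sqrt (pi x)).

Definition source_col (s : R) : 'cV[R]_n := (p / N s) *: (G s *m source0).

Let p_gt0 := pM_gt0.
Let q_gt0 : 0 < 1 - p. Proof. by move: pM2; lra. Qed.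
Let sq_gt0 : 0 < Num.sqrt (1 - p). Proof. by rewrite sqrtr_gt0. Qed.
Let sq2 : Num.sqrt (1 - p) ^+ 2 = 1 - p. Proof. by rewrite sqr_sqrtr// ltW. Qed.

Let N_gt0 s : s <= 1 -> 0 < N s.
Proof. by move=> s1; rewrite ltr_wpDr// mulr_ge0// ?(ltW q_gt0)// subr_ge0. Qed.

(** The coefficient of [stat_col s] is the projection coefficient: the inner product sqrt(1 - s)
    sqrt(1 - p) over the squared norm. *)
Lemma Uvec_source s : 0 <= s -> s <= 1 ->
  Uvec pi M = fun x =>
    (source_col s + (Num.sqrt (1 - s) * Num.sqrt (1 - p) / N s) *: stat_col s) x 0.
Proof.
move=> s0 s1; apply/funext => x; rewrite /source_col mul_diag_mx !mxE /Uvec.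
have s1' : 0 <= 1 - s by rewrite subr_ge0.
have hs := sqr_sqrtr s1'.
have N0 : N s != 0 by rewrite gt_eqF// N_gt0.
case: ifP => _.
  by field; rewrite N0 gt_eqF.
have -> : p / N s * (1 * ((Num.sqrt (1 - p))^-1 * Num.sqrt (pi x))) +
    Num.sqrt (1 - s) * Num.sqrt (1 - p) / N s * (Num.sqrt (1 - s) * Num.sqrt (pi x)) =
    Num.sqrt (pi x) / Num.sqrt (1 - p) *
    ((p + Num.sqrt (1 - s) ^+ 2 * Num.sqrt (1 - p) ^+ 2) / N s).
  by field; rewrite N0 gt_eqF.
by rewrite hs sq2 divff// mulr1.
Qed.

Let sum_M : \sum_(x in M) Num.sqrt (pi x) ^+ 2 = p.
Proof. by apply: eq_bigr => x _; rewrite sqr_sqrtr// ltW. Qed.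

Let sum_MC : \sum_(x | x \notin M) Num.sqrt (pi x) ^+ 2 = 1 - p.
Proof. by rewrite -pMC; apply: eq_bigr => x _; rewrite sqr_sqrtr// ltW. Qed.

Lemma form_ifM (u v : 'cV[R]_n) a b :
  (forall x, u x 0 * v x 0 = (if x \in M then a else b) * Num.sqrt (pi x) ^+ 2) ->
  (u^T *m v) 0 0 = a * p + b * (1 - p).
Proof.
move=> uv; rewrite mx11_sum (bigID (mem M))/= -sum_MC -[in RHS]sum_M !mulr_sumr.
by congr (_ + _); apply: eq_bigr => x xM; rewrite uv ?xM ?(negbTE xM).
Qed.

(** Moving [G s] across reduces the claim to sqrt(pi) being orthogonal to [source0], where M and U
    contribute opposite amounts. *)
Lemma stat_col_source s : s < 1 -> ((stat_col s)^T *m source_col s) 0 0 = 0.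
Proof.
move=> s1; rewrite -scalemxAr mxE mulmxA -(tr_diag_mx (scale_row s)) -trmx_mul scale_stat_col.
rewrite (@form_ifM _ _ (- (Num.sqrt (1 - s) * (Num.sqrt (1 - p) / p)))
   (Num.sqrt (1 - s) * (Num.sqrt (1 - p))^-1)).
  rewrite -[X in _ * (_ + _ * X)]sq2 [X in _ * X](_ : _ = 0) ?mulr0//.
  by field; rewrite !gt_eqF.
by move=> x; rewrite !mxE; case: ifP => _; ring.
Qed.

(** If [y0] solves the Poisson equation of [discr P] with source [source0], then (p/N) G^{-1} y0
    solves that of D(P(s)). In the form G cancels, leaving (p/N)^2 and K = <y0, source0>. *)
Lemma HT_closed_form : exists K : R, forall s lam v, 0 <= s -> s < 1 ->
  spec_dec (D s) lam v -> HT_of lam v (Uvec pi M) = (p / N s) ^+ 2 * K.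
Proof.
have [lam0 [v0 sd0]] := @interp_spec_dec 0 (lexx _) ltr01.
have De0 := interp_stat_col (lexx _) ler01.
have [w [Dw _]] := poisson_sq sd0 (interp_lam_ge0 (lexx _) ltr01 sd0) (stat_col_neq0 0) De0
  (stat_col_source ltr01).
have a0 s : s <= 1 -> p / N s != 0 by move=> s1; rewrite mulf_neq0 ?invr_eq0// gt_eqF// N_gt0.
(* Factoring 1 - D^2 = (1 - D)(1 + D) at s = 0 turns [w] into a solution for [1 - D 0], which [G 0]
   and the scalar carry over to [discr P]. *)
have [y0 Dy0] : exists y0, (1%:M - discr P) *m y0 = source0.
  exists ((p / N 0)^-1 *: (G 0 *m ((1%:M + D 0) *m w))).
  have inj (x y : 'cV[R]_n) : G 0 *m x = G 0 *m y -> x = y.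
    by move=> /(congr1 (mulmx (G' 0))); rewrite !mulmxA scaleVK ?ltr01// !mul1mx.
  apply: inj; rewrite -!scalemxAr !mulmxA -interp_discr ?lexx ?ler01//.
  rewrite (_ : (1%:M - D 0) *m (1%:M + D 0) = 1%:M - D 0 *m D 0); last first.
    by rewrite mulmxDr mulmxBl mulmxBl !mul1mx !mulmx1 addrA subrK.
  by rewrite Dw scalerA mulVf ?scale1r// a0// ler01.
exists ((y0^T *m source0) 0 0) => s lam v s0 s1 sd.
rewrite (Uvec_source s0 (ltW s1)) (HT_of_shift _ _ sd (interp_stat_col s0 (ltW s1))).
rewrite (@HT_of_poisson _ _ _ _ _ ((p / N s) *: (G' s *m y0)) _ sd); last first.
  rewrite -scalemxAr (interp_discr s0 (ltW s1)) -!mulmxA [G s *m (G' s *m _)]mulmxA scaleK//.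
  by rewrite mul1mx Dy0.
rewrite /source_col [(_ *: (G' s *m y0))^T]linearZ /= -scalemxAr -scalemxAl scalerA [LHS]mxE -expr2.
rewrite trmx_mul tr_diag_mx mulmxA -[_ *m G' s *m G s]mulmxA scaleVK// mulmx1 //.
Qed.

End Interpolation.

(** * The walk Hamiltonian *)

Lemma conjC_real (R : realType) (u : R) : Num.Def.conjC (u%:C : R[i]) = u%:C.
Proof. exact: conjc_real. Qed.

Definition swap_index (R : realType) (n : nat) (P : 'M[R]_n) (c : 'I_(n * n)) : 'I_(n * n) :=
  let: (x, y) := mxtens_unindex c in if 0 < P x y then mxtens_index (y, x) else c.

Lemma swap_index_pair (R : realType) (n : nat) (P : 'M[R]_n) x y :
  swap_index P (mxtens_index (x, y)) =
  if 0 < P x y then mxtens_index (y, x) else mxtens_index (x, y).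
Proof. by rewrite /swap_index mxtens_indexK. Qed.

Lemma swapSE (R : realType) (n : nat) (P : 'M[R]_n) r c :
  swapS P r c = (r == swap_index P c)%:R.
Proof.
case: (mxtens_indexP r) => a b; case: (mxtens_indexP c) => x y.
rewrite mxE !mxtens_indexK swap_index_pair /=.
by case: ifP => _; rewrite (can_eq (@mxtens_indexK n n)) xpair_eqE.
Qed.

(* The isometry |y> -> |y,0>. *)
Definition ancilla (R : realType) (n : nat) (z : 'cV[R[i]]_n) : 'M[R[i]]_(n * n, n) :=
  \matrix_(r, y) (((mxtens_unindex r).1 == y)%:R * z (mxtens_unindex r).2 0).

Section Walk.
Variables (R : realType) (n : nat) (P Ps : 'M[R]_n) (V : 'M[R[i]]_(n * n)) (z : 'cV[R[i]]_n).
Hypothesis symP : forall x y, (0 < P x y) = (0 < P y x).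
Hypothesis Ps_ge0 : forall x y, 0 <= Ps x y.
Hypothesis suppP : forall x y, (0 < P x y) = false -> Ps x y = 0.
Hypothesis zz : z ^t* *m z = 1%:M.
Hypothesis VU : V \in unitarymx.
Hypothesis Vx : forall x : 'I_n, V *m (ket x *t z) = ket x *t sqrt_row Ps x.

(** Symmetry of the support of [P] makes S an involution. *)
Lemma swap_indexK : involutive (swap_index P).
Proof.
move=> c; case: (mxtens_indexP c) => x y; rewrite swap_index_pair.
by case: ifP => h; rewrite swap_index_pair ?h// -symP h.
Qed.

Lemma swapS_adj : (swapS P) ^t* = swapS P.
Proof.
apply/matrixP => r c; rewrite mxE [_^T _ _]mxE !swapSE rmorph_nat.
by rewrite eq_sym -(can_eq swap_indexK) swap_indexK.
Qed.

Lemma swapS_mulE p (X : 'M[R[i]]_(n * n, p)) r c : (swapS P *m X) r c = X (swap_index P r) c.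
Proof.
rewrite mxE (bigD1 (swap_index P r))//= swapSE swap_indexK eqxx mul1r big1 ?addr0// => k kr.
rewrite swapSE -(can_eq swap_indexK) swap_indexK eq_sym (negbTE kr) mul0r //.
Qed.

Lemma swapS_sq : swapS P *m swapS P = 1%:M.
Proof.
by apply/matrixP => r c; rewrite swapS_mulE swapSE (can_eq swap_indexK) mxE.
Qed.

Local Notation J := (ancilla z).
Local Notation A := (V ^t* *m swapS P *m V).
Local Notation H := (Hop P V z).
Local Notation toC := (map_mx (real_complex R)).
Local Notation D := (toC (discr Ps)).

Let VV : V *m V ^t* = 1%:M. Proof. exact/unitarymxP. Qed.

Lemma walk_adj : A ^t* = A.
Proof. by rewrite !trmx_mul !map_mxM trmxCK swapS_adj mulmxA. Qed.

Lemma walk_sq : A *m A = 1%:M.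
Proof.
rewrite !mulmxA -[_ *m V *m V ^t*]mulmxA VV mulmx1 -[_ *m swapS P *m swapS P]mulmxA.
by rewrite swapS_sq mulmx1 (mulmx1C VV).
Qed.

Lemma ancilla_tens (w : 'cV[R]_n) : toC w *t z = J *m toC w.
Proof.
apply/matrixP => r c; case: (mxtens_indexP r) => a b; rewrite !mxE !mxtens_indexK /=.
rewrite (bigD1 a)//= big1 ?addr0 => [|k ka]; last first.
  by rewrite !mxE mxtens_indexK eq_sym (negbTE ka) !mul0r.
by rewrite !mxE mxtens_indexK eqxx mul1r [RHS]mulrC !ord1.
Qed.

Lemma ancillaE r y : J r y = (ket y *t z) r 0.
Proof. by rewrite !mxE eq_sym !ord1. Qed.

Let sum_index (F : 'I_(n * n) -> R[i]) :
  \sum_k F k = \sum_a \sum_b F (mxtens_index (a, b)).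
Proof.
rewrite pair_big; apply: reindex => /=; exists (@mxtens_unindex n n) => k _.
  by case: k => a b; exact: mxtens_indexK.
by rewrite -surjective_pairing mxtens_unindexK.
Qed.

Let sum_index1 x (F : 'I_(n * n) -> R[i]) :
  (forall a b, a != x -> F (mxtens_index (a, b)) = 0) ->
  \sum_k F k = \sum_b F (mxtens_index (x, b)).
Proof.
move=> Fx; rewrite sum_index [LHS](bigD1 x)//= [X in _ + X]big1 ?addr0// => a ax.
by apply: big1 => b _; exact: Fx.
Qed.

Lemma ancilla_isom : J ^t* *m J = 1%:M.
Proof.
apply/matrixP => x y; rewrite mxE (sum_index1 (x := x)) => [|a b ax]; last first.
  by rewrite !mxE !mxtens_indexK (negbTE ax) mul0r rmorph0 mul0r.
have := zz => /matrixP/(_ 0 0); rewrite !mxE eqxx mulr1n => h.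
transitivity ((x == y)%:R * \sum_b ((z ^t*) 0 b * z b 0)); last by rewrite h mulr1.
rewrite mulr_sumr; apply: eq_bigr => b _; rewrite !mxE !mxtens_indexK eqxx mul1r mulrCA //.
Qed.

Lemma Pi0_ancilla : Pi0 z = J *m J ^t*.
Proof.
apply/matrixP => r c; case: (mxtens_indexP r) => a b; case: (mxtens_indexP c) => x y.
rewrite tensmxE [RHS]mxE [RHS](bigD1 x)//= [X in _ = _ + X]big1 ?addr0 => [|k kx]; last first.
  by rewrite !mxE !mxtens_indexK [x == k]eq_sym (negbTE kx) mul0r rmorph0 mulr0.
rewrite !mxE !mxtens_indexK eqxx mul1r big_ord1 !mxE mulrA //.
Qed.

Lemma walk_ancilla : V *m J = \matrix_(r, y) ((((mxtens_unindex r).1 == y)%:R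
   * Num.sqrt (Ps y (mxtens_unindex r).2))%:C).
Proof.
apply/matrixP => r y; have /matrixP/(_ r 0) := Vx y; rewrite mxE => h.
rewrite mxE; transitivity (\sum_j V r j * (ket y *t z) j 0).
  by apply: eq_bigr => j _; rewrite ancillaE.
rewrite h !mxE eq_sym rmorphM /= rmorph_nat //.
Qed.

(** Flipping pairs matches the amplitude sqrt(p_xy) with sqrt(p_yx); pairs left unflipped by S carry
    zero amplitude. *)
Lemma walk_compress : J ^t* *m A *m J = D.
Proof.
have -> : J ^t* *m A *m J = (V *m J) ^t* *m (swapS P *m (V *m J)).
  by rewrite [in RHS]trmx_mul map_mxM !mulmxA.
rewrite walk_ancilla; apply/matrixP => x y.
rewrite mxE (sum_index1 (x := x)) => [|a b ax]; last first.
  by move: (swapS P *m _) => X; rewrite !mxE !mxtens_indexK (negbTE ax) mul0r !rmorph0 mul0r.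
transitivity (\sum_b (Num.sqrt (Ps x b) * ((b == y)%:R * Num.sqrt (Ps y x)))%:C).
  apply: eq_bigr => b _; rewrite swapS_mulE swap_index_pair 3!mxE !mxtens_indexK eqxx mul1r.
  rewrite conjC_real; case: ifP => h; rewrite mxE !mxtens_indexK/= -rmorphM//.
  by rewrite suppP// sqrtr0 !mul0r.
rewrite (bigD1 y)//= eqxx mul1r big1 ?addr0 => [|b by_]; last by rewrite (negbTE by_) mul0r mulr0.
by rewrite !mxE sqrtrM.
Qed.

Lemma Hop_adj : H ^t* = H.
Proof.
have PiH : (Pi0 z) ^t* = Pi0 z by rewrite Pi0_ancilla trmx_mul map_mxM trmxCK.
have -> : H = 'i *: (A *m Pi0 z - Pi0 z *m A) by [].
move: walk_adj PiH; move: (A) (Pi0 z) => B Q BH QH.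
rewrite linearZ /= map_mxZ linearB /= map_mxB !trmx_mul !map_mxM BH QH.
have -> : Num.Def.conjC ('i : R[i]) = - 'i by apply/eqP; rewrite eq_complex /= oppr0 !eqxx.
by rewrite scaleNr -scalerN opprB.
Qed.

Lemma Hop_ancilla : H *m J = 'i *: (A *m J - J *m D).
Proof.
rewrite -walk_compress /Hop Pi0_ancilla -scalemxAl; congr (_ *: _).
move: ancilla_isom; move: (A) (J) => B K KK.
by rewrite mulmxBl -!mulmxA KK mulmx1.
Qed.

(** Of the four products in the expansion, two equal A J D and cancel; the others give J and J D^2
    by A^2 = 1 and the compression identity, with sign from i^2 = -1. *)
Lemma Hop_sq_ancilla : H *m (H *m J) = J *m (1%:M - D *m D).
Proof.
rewrite Hop_ancilla /Hop Pi0_ancilla -scalemxAr -scalemxAl scalerA -expr2 sqr_i scaleN1r.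
have := walk_compress; move: ancilla_isom walk_sq; move: (A) (J) (D) => B K E KK BB KBK.
have t1 : B *m (K *m K ^t*) *m (B *m K) = B *m K *m E by rewrite -KBK !mulmxA.
have t2 : B *m (K *m K ^t*) *m (K *m E) = B *m K *m E.
  by rewrite -!mulmxA [K ^t* *m (K *m E)]mulmxA KK mul1mx.
have t3 : K *m K ^t* *m B *m (B *m K) = K.
  by rewrite mulmxA -[_ *m B *m B]mulmxA BB mulmx1 -mulmxA KK mulmx1.
have t4 : K *m K ^t* *m B *m (K *m E) = K *m (E *m E).
  by rewrite -[X in _ = _ *m (X *m _)]KBK !mulmxA.
by rewrite mulmxBl !mulmxBr mulmx1 t1 t2 t3 t4 subrr add0r opprK.
Qed.

Lemma Hop_sq_tens (w : 'cV[R]_n) :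
  H *m (H *m (J *m toC w)) = J *m toC ((1%:M - discr Ps *m discr Ps) *m w).
Proof.
rewrite [H *m (J *m _)]mulmxA [H *m (H *m J *m _)]mulmxA Hop_sq_ancilla -mulmxA.
by rewrite [in RHS]map_mxM map_mxB map_mx1 map_mxM.
Qed.

(** Compressing H to the ancilla space gives i(D - D) = 0. *)
Lemma Hop_orthogonal (u w : 'cV[R]_n) :
  (J *m toC u) ^t* *m (H *m (J *m toC w)) = 0.
Proof.
have JHJ : J ^t* *m (H *m J) = 0.
  rewrite Hop_ancilla -scalemxAr mulmxBr [X in X - _]mulmxA walk_compress.
  by rewrite mulmxA ancilla_isom mul1mx subrr scaler0.
by rewrite trmx_mul map_mxM -mulmxA [H *m _]mulmxA [J ^t* *m _]mulmxA JHJ mul0mx mulmx0.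
Qed.

Lemma normsq_ancilla (w : 'cV[R]_n) : normsq (J *m toC w) = (w^T *m w) 0 0.
Proof.
rewrite normsq_unitary ?ancilla_isom// mxE; apply: eq_bigr => x _.
by rewrite !mxE /= expr0n addr0 expr2.
Qed.

Lemma normsq_Hop (w : 'cV[R]_n) :
  normsq (H *m (J *m toC w)) = (w^T *m ((1%:M - discr Ps *m discr Ps) *m w)) 0 0.
Proof.
have := normsqE (H *m (J *m toC w)).
rewrite trmx_mul map_mxM Hop_adj -mulmxA Hop_sq_tens trmx_mul map_mxM.
rewrite -mulmxA [J ^t* *m _]mulmxA ancilla_isom mul1mx.
have -> : (toC w) ^t* = toC w^T.
  by apply/matrixP => i j; rewrite !mxE conjC_real.
rewrite -map_mxM => /matrixP/(_ 0 0); rewrite [LHS]mxE [RHS]mxE eqxx mulr1n => /complexI <- //.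
Qed.

Lemma Hop_fixed (e : 'cV[R]_n) : discr Ps *m e = e -> H *m (J *m toC e) = 0.
Proof.
move=> De; apply: normsq_eq0; rewrite normsq_Hop mulmxBl mul1mx -mulmxA !De subrr.
by rewrite mulmx0 mxE.
Qed.

End Walk.

(** * The success probability *)

Lemma trace_PiM (R : realType) (n : nat) (M : {set 'I_n}) (X : 'M[R[i]]_(n * n)) :
  \tr ((PiM M *t (1%:M : 'M[R[i]]_n)) *m X) =
  \sum_(k | (mxtens_unindex k).1 \in M) X k k.
Proof.
have -> : PiM M *t (1%:M : 'M[R[i]]_n) = diag_mx (\row_k ((mxtens_unindex k).1 \in M)%:R).
  apply/matrixP => r c; case: (mxtens_indexP r) => a b; case: (mxtens_indexP c) => x y.
  rewrite !mxE !mxtens_indexK /= (can_eq (@mxtens_indexK n n)) xpair_eqE.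
  case: (a =P x) => [->|_] /=; last by rewrite mul0r mulr0n.
  by case: (b == y); rewrite ?mulr1 ?mulr0 ?mulr1n ?mulr0n.
rewrite mul_diag_mx /mxtrace [RHS]big_mkcond; apply: eq_bigr => k _.
by rewrite !mxE; case: ifP => _; rewrite ?mul1r ?mul0r.
Qed.

Lemma sqr_ratio_cvg_left (R : realType) (p K : R) : p != 0 ->
  ((p / (p + (1 - s) * (1 - p))) ^+ 2 * K @[s --> (1 : R)^'-] --> K)%classic.
Proof.
move=> p0; apply: cvg_at_left_filter.
have cN : (p + (1 - s) * (1 - p) @[s --> (1 : R)] --> p + (1 - 1) * (1 - p))%classic.
  apply: cvgD; first exact: cvg_cst.
  by apply: cvgMr_tmp; apply: cvgB; [exact: cvg_cst|exact: cvg_id].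
have e1 : p + (1 - 1) * (1 - p) = p by rewrite subrr mul0r addr0.
rewrite e1 in cN.
have c1 : (p / (p + (1 - s) * (1 - p)) @[s --> (1 : R)] --> p / p)%classic.
  by apply: cvgMl_tmp; apply: cvgV.
have c2 : ((p / (p + (1 - s) * (1 - p))) ^+ 2 * K @[s --> (1 : R)] --> p / p * (p / p) * K)%classic.
  by apply: cvgMr_tmp; apply: cvgM; exact: c1.
by rewrite divff// !mul1r in c2.
Qed.

Lemma limit_HT (R : realType) (HT : R -> R) (HTplus p K : R) : p != 0 ->
  (forall s, 0 <= s < 1 -> HT s = (p / (p + (1 - s) * (1 - p))) ^+ 2 * K) ->
  (HT s @[s --> (1 : R)^'-] --> HTplus)%classic -> HTplus = K.
Proof.
move=> p0 HTE cHT.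
transitivity (lim (HT s @[s --> (1 : R)^'-]))%classic; first exact/esym/cvg_lim.
apply: cvg_lim => //; have := sqr_ratio_cvg_left (K := K) p0.
apply: cvg_trans; apply: near_eq_cvg; near=> s; apply/esym/HTE/andP; split.
  by near: s; apply: nbhs_left_ge.
by near: s; exact: nbhs_left_lt.
Unshelve. all: by end_near.
Qed.

Lemma interp_sstar (R : realType) (n : nat) (pi : 'I_n -> R) (M : {set 'I_n}) :
  0 < pM pi M -> pM pi M <= 2^-1 ->
  [/\ 0 <= sstar pi M, sstar pi M < 1 & 1 - sstar pi M = pM pi M / (1 - pM pi M)].
Proof.
set p := pM pi M => p0 p2; have q0 : 0 < 1 - p by lra.
rewrite /sstar -/p; split; last by ring.
- by rewrite subr_ge0 ler_pdivrMr// mul1r; lra.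
- by rewrite gtrBl divr_gt0.
Qed.

(** At s^star, (1 - s)(1 - p) = p, so [stat_col] has squared norm 2p, p/N is 1/2 and sqrt(1 - s) =
    sqrt(p)/sqrt(1 - p). The first coefficient is the projection on [stat_col]. *)
Lemma sqrt_col_decomp (R : realType) (n : nat) (pi : 'I_n -> R) (M : {set 'I_n})
  (p := pM pi M) (s := sstar pi M) :
  0 < p -> p <= 2^-1 ->
  sqrt_col pi = ((Num.sqrt p + Num.sqrt (1 - p)) / (2 * Num.sqrt p)) *: stat_col pi M s
    + (Num.sqrt (1 - p) - Num.sqrt p) *: source_col pi M s.
Proof.
move=> p0 p2; have q0 : 0 < 1 - p by lra.
have [_ _ ss] := interp_sstar p0 p2.
have sp : Num.sqrt p ^+ 2 = p by rewrite sqr_sqrtr// ltW.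
have sq : Num.sqrt (1 - p) ^+ 2 = 1 - p by rewrite sqr_sqrtr// ltW.
have sp0 : Num.sqrt p != 0 by rewrite gt_eqF// sqrtr_gt0.
have sq0 : Num.sqrt (1 - p) != 0 by rewrite gt_eqF// sqrtr_gt0.
have ssq : Num.sqrt (1 - s) = Num.sqrt p / Num.sqrt (1 - p).
  by rewrite ss sqrtrM ?ltW// sqrtrV ?ltW.
have half : p / (p + (1 - s) * (1 - p)) = 2^-1.
  by rewrite ss -/p; field; rewrite !gt_eqF//; lra.
apply/matrixP => x j; rewrite /source_col mul_diag_mx !mxE -/p half ssq.
move: (Num.sqrt (pi x)) => r; case: ifP => _.
  rewrite (_ : Num.sqrt (1 - p) / p = Num.sqrt (1 - p) / Num.sqrt p ^+ 2); last by rewrite sp.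
  field; exact/andP.
by field; exact/andP.
Qed.

Unset Implicit Arguments.

Theorem theorem2 (R : realType) (n : nat) (P : 'M[R]_n) (pi : 'I_n -> R)
  (M : {set 'I_n}) (HT : R -> R) (HTplus : R)
  (z : 'cV[R[i]]_n) (V : 'M[R[i]]_(n * n)) :
  lazy_chain P -> ergodic P -> stationary P pi -> reversible P pi ->
  M != finset.set0 -> pM pi M <= 2^-1 ->
  (* HT(s) via the spectral decomposition of D(P(s)), s in [0,1) *)
  (forall s : R, 0 <= s < 1 ->
     forall (lam : 'I_n -> R) (v : 'I_n -> 'I_n -> R),
       spec_dec (discr (interp P M s)) lam v -> HT s = HT_of lam v (Uvec pi M)) ->
  (* HT^+(P,M) = lim_{s -> 1} HT(s) *)
  (HT s @[s --> (1 : R)^'-] --> HTplus)%classic ->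
  (* |0> is a (unit) reference state *)
  z ^t* *m z = 1%:M ->
  (* V(s^star) is unitary with V(s^star)|x,0> = sum_y sqrt(p_xy(s^star)) |x,y> *)
  V \in unitarymx ->
  (forall x : 'I_n,
     V *m (ket x *t z) = ket x *t sqrt_row (interp P M (sstar pi M)) x) ->
  forall eps T : R, 0 < eps < 4^-1 -> 0 < T ->
    eps^-1 * Num.sqrt (HTplus / 2) <= T ->
    (4^-1 - eps)%:C <=
      \tr ((PiM M *t (1%:M : 'M[R[i]]_n))
             *m rhobar (Hop P V z) (psi0 pi z) T).
Proof.
move=> lazyP [stP [irrP _]] stat revP M0 pM2 HTE cHT zz VU Vx eps T /andP[eps0 _] T0 Tge.
have pi_gt0 := stationary_gt0 stP irrP stat.
have [_ [pi1 _]] := stat; have [P0 _] := stP.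
have p_gt0 := pM_gt0 pi_gt0 M0.
have [s0 s1 ss] := interp_sstar p_gt0 pM2.
set p := pM pi M in p_gt0 pM2 ss *; set s := sstar pi M in s0 s1 ss Vx.
have q_gt0 : 0 < 1 - p by lra.
have [K HK] := HT_closed_form lazyP stP irrP pi_gt0 revP pi1 M0 pM2.
have HTK t : 0 <= t < 1 -> HT t = (p / (p + (1 - t) * (1 - p))) ^+ 2 * K.
  move=> t01; have /andP[t0 t1] := t01.
  have [lam [v sd]] := interp_spec_dec stP irrP pi_gt0 revP M0 t0 t1.
  by rewrite (HTE _ t01 _ _ sd) (HK _ _ _ t0 t1 sd).
have HTplusK : HTplus = K := limit_HT (lt0r_neq0 p_gt0) HTK cHT.
have [lam [v sd]] := interp_spec_dec stP irrP pi_gt0 revP M0 s0 s1.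
have De := interp_stat_col M stP pi_gt0 revP s0 (ltW s1).
have [w [Dw wg]] := poisson_sq sd (interp_lam_ge0 lazyP stP pi_gt0 revP s0 s1 sd)
  (stat_col_neq0 pi_gt0 M0 s) De (stat_col_source pi_gt0 pi1 M0 pM2 s1).
have wgK : (w^T *m source_col pi M s) 0 0 <= HTplus / 4.
  apply: (le_trans wg); have := HK _ _ _ s0 s1 sd.
  rewrite (Uvec_source pi_gt0 M0 pM2 s0 (ltW s1)) (HT_of_shift _ _ sd De) => ->.
  have -> : p / (p + (1 - s) * (1 - p)) = 2^-1.
    by rewrite ss; field; rewrite !gt_eqF//; lra.
  by rewrite HTplusK le_eqVlt; apply/orP; left; apply/eqP; field.
have symP x y : (0 < P x y) = (0 < P y x).
  by rewrite -(pmulr_rgt0 (P x y) (pi_gt0 x)) revP pmulr_rgt0.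
pose Ps := interp P M s.
have Ps_ge0 x y : 0 <= Ps x y.
  rewrite /Ps !mxE; apply: addr_ge0; apply: mulr_ge0 => //; first by rewrite subr_ge0 ltW.
  by case: (x \in M); rewrite ?ler0n.
(* Interpolation can add weight only on the diagonal, where laziness already makes [P] positive. *)
have suppP x y : (0 < P x y) = false -> Ps x y = 0.
  move=> nP; have Pxy : P x y = 0.
    by apply/eqP; rewrite eq_le P0 andbT leNgt nP.
  have xy : x != y.
    apply: contraFneq nP => <-; have [Q [[Q0 _] ->]] := lazyP.
    by rewrite !mxE eqxx mulr_gt0 ?invr_gt0// ltr_pwDl.
  by rewrite /Ps !mxE Pxy (negbTE xy); case: ifP => _; rewrite !mulr0 addr0.
have [Q [mu [QU HE]]] := hermitian_spectral (Hop_adj V z symP).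
pose c0 := Num.sqrt (1 - p) - Num.sqrt p.
pose J := ancilla z; pose toC k (X : 'cV[R]_k) := map_mx (real_complex R) X.
pose a := (Num.sqrt p + Num.sqrt (1 - p)) / (2 * Num.sqrt p).
pose phi := J *m toC n (stat_col pi M s).
pose chi := J *m toC n (c0 *: w).
(* The source part of the initial state is (1 - D^2) applied to c0 w, which is H^2 on the ancilla
   space. *)
have psiE : psi0 pi z = a%:C *: phi + Hop P V z *m (Hop P V z *m chi).
  transitivity (J *m toC n (sqrt_col pi)).
    rewrite -[RHS]ancilla_tens /psi0 (_ : \col_x _ = toC n (sqrt_col pi))//.
    by apply/matrixP => x y; rewrite !mxE.
  rewrite (Hop_sq_tens symP Ps_ge0 suppP zz VU Vx).
  rewrite -scalemxAr Dw (sqrt_col_decomp p_gt0 pM2) -/a -/c0.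
  by rewrite /toC map_mxD mulmxDr map_mxZ -scalemxAr.
set chi' := Hop P V z *m chi in psiE.
have Hphi : Hop P V z *m phi = 0 := Hop_fixed symP Ps_ge0 suppP zz VU Vx De.
pose eM : 'cV[R]_n := \col_x (if x \in M then stat_col pi M s x 0 else 0).
pose inM (k : 'I_(n * n)) := (mxtens_unindex k).1 \in M.
have phiSE : \col_k (if inM k then phi k 0 else 0) = J *m toC n eM.
  rewrite /phi -!ancilla_tens; apply/matrixP => k j; rewrite !mxE /inM.
  by rewrite (ord1 j); case: ifP => hk; rewrite ?hk // rmorph0 mul0r.
have phiS_chi : (J *m toC n eM) ^t* *m chi' = 0 := Hop_orthogonal symP Ps_ge0 suppP zz Vx _ _.
(* On M the entries of [stat_col] are sqrt(pi_x), whatever s is. *)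
have n_phiS : normsq (J *m toC n eM) = p.
  rewrite (normsq_ancilla zz) mx11_sum /p /pM [RHS]big_mkcond; apply: eq_bigr => x _.
  rewrite !mxE; case: ifP => hx; rewrite ?hx ?mul0r//.
  by rewrite !mul1r -expr2 sqr_sqrtr// ltW.
have n_chi : normsq chi' = c0 ^+ 2 * (w^T *m source_col pi M s) 0 0.
  rewrite (normsq_Hop symP Ps_ge0 suppP zz VU Vx) -scalemxAr Dw.
  by rewrite [(c0 *: w)^T]linearZ /= -scalemxAr -scalemxAl scalerA [LHS]mxE expr2.
have sp_gt0 : 0 < Num.sqrt p by rewrite sqrtr_gt0.
have sq_gt0 : 0 < Num.sqrt (1 - p) by rewrite sqrtr_gt0.
have a0 : 0 <= a by rewrite divr_ge0 ?addr_ge0 ?mulr_ge0// ltW.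
have c0_ge0 : 0 <= c0.
  by rewrite subr_ge0; apply: ler_wsqrtr; lra.
have := @rhobar_sum_ge _ _ _ mu QU phi chi' a T inM.
rewrite /= phiSE -HE => /(_ Hphi a0 T0 phiS_chi); rewrite -psiE n_phiS => lower.
rewrite trace_PiM lecE /= Imc_sum Rec_sum; apply/andP; split.
  by rewrite big1// => k _; rewrite HE rhobar_diag_real.
apply: le_trans lower.
have sp : Num.sqrt p ^+ 2 = p by rewrite sqr_sqrtr// ltW.
have sq : Num.sqrt (1 - p) ^+ 2 = 1 - p by rewrite sqr_sqrtr// ltW.
(* Here a^2 p = (sqrt(p) + sqrt(1 - p))^2 / 4, and p + (1 - p) = 1 yields the constant 1/4. *)
have -> : a ^+ 2 * p = 4^-1 + Num.sqrt p * Num.sqrt (1 - p) / 2.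
  rewrite /a -[X in _ * X]sp.
  have -> : ((Num.sqrt p + Num.sqrt (1 - p)) / (2 * Num.sqrt p)) ^+ 2 * Num.sqrt p ^+ 2 =
    (Num.sqrt p ^+ 2 + Num.sqrt (1 - p) ^+ 2) / 4 + Num.sqrt p * Num.sqrt (1 - p) / 2.
    by field; rewrite gt_eqF.
  by rewrite sp sq [p + _]addrC subrK div1r.
have -> : 2 * a / T * Num.sqrt (p * normsq chi') =
    (Num.sqrt p + Num.sqrt (1 - p)) * Num.sqrt (normsq chi') / T.
  by rewrite sqrtrM ?ltW// /a; field; rewrite !gt_eqF.
(* The bound HT^+/4 is relaxed to HT^+/2 to match the hypothesis on [T]. *)
have chi_le : Num.sqrt (normsq chi') <= c0 * Num.sqrt (HTplus / 2).
  apply: (le_trans (y := Num.sqrt (c0 ^+ 2 * (HTplus / 4)))).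
    by rewrite ler_wsqrtr// n_chi ler_wpM2l// sqr_ge0.
  rewrite sqrtrM ?sqr_ge0// sqrtr_sqr ger0_norm// ler_wpM2l//.
  (* For negative [HTplus] the left square root takes its default value 0. *)
  case: (lerP 0 HTplus) => h; first by rewrite ler_wsqrtr//; lra.
  by rewrite ler0_sqrtr ?sqrtr_ge0//; lra.
have HT_le : Num.sqrt (HTplus / 2) <= eps * T by rewrite -ler_pdivrMl.
(* The prefactors multiply to (1 - p) - p = 1 - 2p <= 1. *)
have main : (Num.sqrt p + Num.sqrt (1 - p)) * Num.sqrt (normsq chi') / T <= eps.
  rewrite ler_pdivrMr//.
  apply: (le_trans (y := (Num.sqrt p + Num.sqrt (1 - p)) * (c0 * Num.sqrt (HTplus / 2)))).
    by rewrite ler_wpM2l// addr_ge0// ltW.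
  have -> : (Num.sqrt p + Num.sqrt (1 - p)) * (c0 * Num.sqrt (HTplus / 2)) =
      (Num.sqrt (1 - p) ^+ 2 - Num.sqrt p ^+ 2) * Num.sqrt (HTplus / 2) by rewrite /c0; ring.
  apply: le_trans HT_le; rewrite sp sq ler_piMl ?sqrtr_ge0//; lra.
have cross : 0 <= Num.sqrt p * Num.sqrt (1 - p) / 2 by rewrite !mulr_ge0 ?ltW.
lra.
Qed.
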